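(* $\sigma_\infty\subset\pi_\infty^{\mathcal{S}}$, so that $\pi_\infty^{\mathcal{S}}$ is dense in $\Sigma_\pi$ and $\Sigma_\pi:=\overline{\pi_\infty}=\overline{\sigma_\infty}=\overline{\pi_\infty^{\mathcal{S}}}$.
   Context: For $c\in\{\pm1\}^{\mathbb{Z}}$ let $A_c$ be the bounded operator on $\ell^2(\mathbb{Z})$ given by $(A_c\phi)_m=c_m\phi_{m-1}+\phi_{m+1}$, $m\in\mathbb{Z}$. For $n\in\mathbb{N}$ and $k\in\{\pm1\}^n$, $A_k^{\mathrm{per}}$ denotes $A_c$ for the $n$-periodic sequence $c$ ($c_{m+n}=c_m$ for all $m\in\mathbb{Z}$) with $c_m=k_m$ for $m=1,\dots,n$. $\operatorname{spec}$ denotes the spectrum (as an operator on $\ell^2(\mathbb{Z})$), or the set of eigenvalues for a finite matrix. $\pi_\infty:=\bigcup_{n\in\mathbb{N}}\bigcup_{k\in\{\pm1\}^n}\operatorname{spec}A_k^{\mathrm{per}}$. $\mathcal{K}$ is the set of all $k=(k_1,\dots,k_n)\in\{\pm1\}^n$, $n\ge2$, with $k_{n-1}=-1$, $k_n=1$, and such that either $n=2$, or $n\ge3$ and $k_j=k_{n-j-1}$ for $1\le j\le n-2$. $\pi_\infty^{\mathcal{S}}:=\bigcup_{k\in\mathcal{K}}\operatorname{spec}A_k^{\mathrm{per}}$. For $n\ge 2$ and $k\in\{\pm1\}^n$, $A_k^{(n)}$ is the $n\times n$ tridiagonal matrix with zero main diagonal, all first superdiagonal entries equal to $1$, and first subdiagonal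 entries $k_1,\dots,k_{n-1}$; for $n=1$ it is the $1\times1$ zero matrix. $\sigma_n:=\bigcup_{k\in\{\pm1\}^n}\operatorname{spec}A_k^{(n)}$ and $\sigma_\infty:=\bigcup_{n=1}^\infty\sigma_n$. *)

(* Defs.v *)
From HB Require Import structures.
From mathcomp Require Import all_boot all_order all_algebra.
From mathcomp Require Import all_classical all_reals all_analysis.
From mathcomp Require Import complex lra.
Set Implicit Arguments.
Unset Strict Implicit.
Unset Printing Implicit Defensive.
Import Order.TTheory GRing.Theory Num.Theory.
Import numFieldNormedType.Exports.
Import ComplexField.Normc.
Local Open Scope classical_set_scope.
Local Open Scope ring_scope.

(* The tag ^o selects the structure of R[i] as a module (and a normed, hence
   topological, space) over itself rather than over R. *)
Notation Cplx R := (R[i])^o.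

Section Ell2.
Variable R : realType.
Implicit Types (phi psi : int -> Cplx R).

Definition sqsum phi : \bar R :=
  (\esum_(m in [set: int]) ((normc (phi m)) ^+ 2)%:E)%E.

Definition sqsummable : {pred int -> Cplx R} :=
  [pred phi | (sqsum phi < +oo)%E].

Lemma esumZ_le (M : R) (u : int -> R) : 0 <= M -> (forall m, 0 <= u m) ->
  (\esum_(m in [set: int]) (M * u m)%:E
    <= M%:E * \esum_(m in [set: int]) (u m)%:E)%E.
Proof.
move=> M0 u0; apply: ge_ereal_sup => _ [X [finX _]] <-.
under eq_fsbigr do rewrite EFinM.
rewrite -ge0_mule_fsumr; last by move=> i; rewrite lee_fin.
apply: lee_pmul => //.
- by rewrite fsume_ge0// => i _; rewrite lee_fin.
- by apply: esum_ge; exists X.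
Qed.

Lemma sqsum_le (M : R) phi psi chi : 0 <= M ->
  (forall m, normc (chi m) ^+ 2 <=
             M * normc (phi m) ^+ 2 + M * normc (psi m) ^+ 2) ->
  (sqsum chi <= M%:E * sqsum phi + M%:E * sqsum psi)%E.
Proof.
move=> M0 h.
apply: (@le_trans _ _ (\esum_(m in [set: int])
  ((M * normc (phi m) ^+ 2)%:E + (M * normc (psi m) ^+ 2)%:E))%E).
  by apply: le_esum => m _; rewrite -EFinD lee_fin.
rewrite esumD; last 2 first.
- by move=> m _; rewrite lee_fin mulr_ge0// sqr_ge0.
- by move=> m _; rewrite lee_fin mulr_ge0// sqr_ge0.
by apply: leeD; apply: esumZ_le => // m; rewrite sqr_ge0.
Qed.

Lemma sqsum_ge0 phi : (0 <= sqsum phi)%E.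
Proof. by apply: esum_ge0 => m _; rewrite lee_fin sqr_ge0. Qed.

Lemma sqsum_fin phi : phi \in sqsummable -> sqsum phi \is a fin_num.
Proof. by rewrite inE ge0_fin_numE// sqsum_ge0. Qed.

Lemma sqsummable_le (M : R) phi psi chi : 0 <= M ->
  (forall m, normc (chi m) ^+ 2 <=
             M * normc (phi m) ^+ 2 + M * normc (psi m) ^+ 2) ->
  phi \in sqsummable -> psi \in sqsummable -> chi \in sqsummable.
Proof.
move=> M0 h hphi hpsi; rewrite inE.
apply: (le_lt_trans (sqsum_le M0 h)).
by rewrite ltey_eq fin_numD !fin_numM// sqsum_fin.
Qed.

Lemma normc_ge0 (x : R[i]) : 0 <= normc x.
Proof. by case: x => a b; exact: sqrtr_ge0. Qed.

Lemma sqr_normcD_le (x y : R[i]) :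
  normc (x + y) ^+ 2 <= 2 * normc x ^+ 2 + 2 * normc y ^+ 2.
Proof.
have /le_trans -> // : normc (x + y) ^+ 2 <= (normc x + normc y) ^+ 2.
  rewrite ler_sqr ?nnegrE ?addr_ge0 ?normc_ge0//; exact: le_normcD.
by have := sqr_ge0 (normc x - normc y); rewrite sqrrB sqrrD; lra.
Qed.

Lemma sqsummable_submod : submod_closed sqsummable.
Proof.
split.
- rewrite inE /sqsum esum1 ?ltry// => m _.
  by rewrite [normc _]normc0 expr0n.
- move=> a phi psi hphi hpsi.
  apply: (@sqsummable_le (Num.max 2 (2 * normc a ^+ 2)) phi psi) => //.
    by rewrite le_max ler0n.
  move=> m; apply: (le_trans (sqr_normcD_le _ _)).
  rewrite [normc (_ *: _)]normcM exprMn mulrA.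
  by apply: lerD; apply: ler_wpM2r; rewrite ?sqr_ge0// le_max lexx ?orbT.
Qed.

HB.instance Definition _ :=
  GRing.isSubmodClosed.Build _ _ sqsummable sqsummable_submod.

Record ell2 := Ell2 { ell2_val :> int -> Cplx R ; _ : ell2_val \in sqsummable }.
HB.instance Definition _ := [isSub for ell2_val].
HB.instance Definition _ := [Choice of ell2 by <:].
HB.instance Definition _ := [SubChoice_isSubLmodule of ell2 by <:].

Definition l2norm (phi : ell2) : R := Num.sqrt (fine (sqsum phi)).

Definition bounded_op (T : ell2 -> ell2) :=
  exists M : R, forall phi : ell2, l2norm (T phi) <= M * l2norm phi.

Definition spec (T : {linear ell2 -> ell2}) : set (Cplx R) :=
  [set lambda | ~ exists S : {linear ell2 -> ell2},
     [/\ bounded_op S,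
         forall phi : ell2, S (T phi - lambda *: phi) = phi &
         forall phi : ell2, T (S phi) - lambda *: S phi = phi]].

End Ell2.

(* A sign in {1, -1} is encoded by a boolean b standing for (-1)^b, so that
   false stands for 1 and true for -1. *)
Section Hopping.
Variable R : realType.

Definition hop_fun (c : int -> bool) (phi : int -> Cplx R) : int -> Cplx R :=
  fun m => (-1) ^+ c m * phi (m - 1) + phi (m + 1).

Lemma sqsum_shift (a : int) (phi : int -> Cplx R) :
  sqsum (fun m => phi (m + a)) = sqsum phi.
Proof.
rewrite /sqsum [RHS](reindex_esum [set: int] _ (fun m => m + a))//.
split=> //.
- by move=> x y _ _; apply: addIr.
- by move=> y _; exists (y - a) => //=; rewrite subrK.
Qed.

Lemma hop_fun_le c (phi : int -> Cplx R) m :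
  normc (hop_fun c phi m) ^+ 2 <=
  2 * normc (phi (m - 1)) ^+ 2 + 2 * normc (phi (m + 1)) ^+ 2.
Proof.
apply: (le_trans (sqr_normcD_le _ _)).
rewrite normcM; suff -> : normc ((-1) ^+ c m : R[i]) = 1 by rewrite mul1r.
by case: (c m); rewrite ?expr1 ?expr0 ?normcN normc1.
Qed.

Lemma hop_sqsummable c (phi : ell2 R) :
  hop_fun c phi \in @sqsummable R.
Proof.
case: phi => phi hphi /=.
apply: (sqsummable_le (ler0n _ 2) (hop_fun_le c phi)); rewrite inE.
- by rewrite (sqsum_shift (-1)).
- by rewrite (sqsum_shift 1).
Qed.

Definition hop (c : int -> bool) (phi : ell2 R) : ell2 R :=
  Ell2 (hop_sqsummable c phi).

Lemma hop_is_linear c : linear (hop c).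
Proof.
move=> a phi psi; apply/val_inj/funext => m.
by rewrite /= /hop_fun !fctE /= mulrDr scalerDr addrACA -scalerAr.
Qed.

HB.instance Definition _ c :=
  GRing.isLinear.Build _ _ _ _ (hop c) (hop_is_linear c).

Lemma hop_bounded c : bounded_op (hop c).
Proof.
exists 2 => phi.
have h := sqsum_le (ler0n _ 2) (hop_fun_le c phi).
rewrite (sqsum_shift (-1)) (sqsum_shift 1) in h.
have hphi := sqsum_fin (valP phi).
have hT := sqsum_fin (valP (hop c phi)).
rewrite /l2norm -[X in X * _](ger0_norm (ler0n _ 2)) -sqrtr_sqr.
rewrite -sqrtrM ?sqr_ge0// ler_wsqrtr// -lee_fin EFinM !fineK//.
rewrite -ge0_muleDl ?lee_fin// -EFinD in h.
by apply: le_trans h _; rewrite lee_wpmul2r ?sqsum_ge0// lee_fin; lra.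
Qed.

(* The n-periodic sequence c with c_m = k_m for m = 1, ..., n, where the
   0-based nth false k j is k_(j+1). *)
Definition per_seq n (k : n.-tuple bool) (m : int) : bool :=
  nth false k `|((m - 1) %% n)%Z|%N.

Lemma per_seq_periodic n (k : n.-tuple bool) m :
  per_seq k (m + n%:Z) = per_seq k m.
Proof. by rewrite /per_seq addrAC modzDr. Qed.

Lemma per_seqE n (k : n.-tuple bool) (j : nat) : (0 < j <= n)%N ->
  per_seq k j%:Z = nth false k j.-1.
Proof.
case: j => // j /= jn.
by rewrite /per_seq -addn1 PoszD addrK modz_nat modn_small.
Qed.

Definition A_per n (k : n.-tuple bool) : {linear ell2 R -> ell2 R} :=
  hop (per_seq k).

Definition pi_inf : set (Cplx R) :=
  \bigcup_(n in [set n | (0 < n)%N])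
    \bigcup_(k in [set: n.-tuple bool]) spec (A_per k).

(* Here k_ is indexed from 1, and true, false stand for -1, 1. *)
Definition in_K n (k : n.-tuple bool) : Prop :=
  let k_ j := nth false k j.-1 in
  [/\ (2 <= n)%N, k_ n.-1 = true, k_ n = false &
      n = 2%N \/ ((3 <= n)%N /\
        forall j, (1 <= j <= n - 2)%N -> k_ j = k_ (n - j - 1)%N)].

Definition pi_inf_S : set (Cplx R) :=
  \bigcup_n \bigcup_(k in [set k : n.-tuple bool | in_K k]) spec (A_per k).

Definition A_fin n (k : n.-tuple bool) : 'M[R[i]]_n :=
  \matrix_(i, j) if j == i.+1 :> nat then 1
                 else if i == j.+1 :> nat then (-1) ^+ nth false k j
                 else 0.

Definition sigma n : set (Cplx R) :=
  \bigcup_(k in [set: n.-tuple bool]) [set lambda | eigenvalue (A_fin k) lambda].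

Definition sigma_inf : set (Cplx R) :=
  \bigcup_(n in [set n | (0 < n)%N]) sigma n.

Definition Sigma_pi : set (Cplx R) := closure pi_inf.

End Hopping.
Arguments A_per R {n} k.
Arguments A_fin R {n} k.
Arguments pi_inf R _ : clear implicits.
Arguments pi_inf_S R _ : clear implicits.
Arguments sigma R n _ : clear implicits.
Arguments sigma_inf R _ : clear implicits.
Arguments Sigma_pi R _ : clear implicits.

Definition dense_in (T : topologicalType) (A B : set T) :=
  A `<=` B /\ B `<=` closure A.

(* Main.v *)
From HB Require Import structures.
Require Import Defs.
From mathcomp Require Import all_boot all_order all_algebra.
From mathcomp Require Import all_classical all_reals all_analysis.
From mathcomp Require Import complex.
From mathcomp Require Import ring lra zify.
Set Implicit Arguments.
Unset Strict Implicit.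
Unset Printing Implicit Defensive.
Import Order.TTheory GRing.Theory Num.Theory.
Import numFieldNormedType.Exports.
Import ComplexField.Normc.
Local Open Scope classical_set_scope.
Local Open Scope ring_scope.

(** Write K_j for the continuants, i.e. the solution of
    u (j + 2) = x u (j + 1) - c_j u j with u 0 = 0, u 1 = 1; x is an
    eigenvalue of the n x n matrix iff K_(n+1) vanishes.

    sigma_inf is contained in pi_inf_S: if the solution of (A_c - x) phi = 0
    with phi (-1) = 0 vanishes again at n, continue the signs by a palindrome
    centred after n; the solution is reflected, up to signs, at its zero n, so
    it vanishes at 2n + 1 too, and the two extra signs -1, 1 close the period
    2n + 2 up to the sign of phi. Truncations of this bounded solution show
    that A_c - x has no bounded inverse.

    pi_inf is contained in the closure of sigma_inf: let V be the shift by one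
    period, t and d = 1 or -1 the trace and the determinant of the monodromy
    matrix. Cayley-Hamilton gives a bounded finite-band operator B with
    B (A_c - x) = (A_c - x) B = V - t + d V^-1. If X^2 - t X + d has no
    unimodular root, the right-hand side is inverted by Neumann series, so x
    is not in the spectrum. Hence on the spectrum t(x) = r + d / r with
    |r| = 1. Since t is a monic polynomial in x, moving r to a nearby root of
    unity moves x only slightly to a point where all solutions are periodic,
    so that some continuant vanishes there. *)

(** * Second order recurrences and monodromy *)

(** The forcing term [f] lets one recursion serve both (A_c - x) phi = 0 and (A_c - x) phi = f. *)
Fixpoint recur (A : pzRingType) (x : A) (c : nat -> bool) (f : nat -> A)
    (a b : A) (j : nat) : A :=
  match j with
  | 0 => a
  | j1.+1 => if j1 is j2.+1
      then x * recur x c f a b j1 - (-1) ^+ c j2 * recur x c f a b j2 + f j2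
      else b
  end.

Section Recurrence.
Variable A : comNzRingType.
Implicit Types (x a b : A) (c : nat -> bool) (f : nat -> A).

Lemma recurSS x c f a b j : recur x c f a b j.+2 =
  x * recur x c f a b j.+1 - (-1) ^+ c j * recur x c f a b j + f j.
Proof. by []. Qed.

Lemma recur_unique x c f (u : nat -> A) :
  (forall j, u j.+2 = x * u j.+1 - (-1) ^+ c j * u j + f j) ->
  forall j, u j = recur x c f (u 0) (u 1) j.
Proof.
move=> uE j; suff [] : u j = recur x c f (u 0) (u 1) j /\
   u j.+1 = recur x c f (u 0) (u 1) j.+1 by [].
elim: j => [//|j [IH1 IH2]]; split=> //.
by rewrite recurSS uE IH1 IH2.
Qed.

Lemma eq_recur x c c' f f' a b j :
  (forall i, (i.+1 < j)%N -> c i = c' i) -> (forall i, (i.+1 < j)%N -> f i = f' i) ->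
  recur x c f a b j = recur x c' f' a b j.
Proof.
elim/ltn_ind: j => -[//|[//|j]] IH cc ff.
rewrite !recurSS cc// ff// !IH// => i ij; by [apply: cc; lia|apply: ff; lia].
Qed.

Definition contin x c j := recur x c (fun=> 0) 0 1 j.

Lemma continSS x c j :
  contin x c j.+2 = x * contin x c j.+1 - (-1) ^+ c j * contin x c j.
Proof. by rewrite /contin recurSS addr0. Qed.

(* The first sign [c 0] multiplies [contin x c 0 = 0]. *)
Lemma eq_contin x c c' j :
  (forall i, (i.+2 < j)%N -> c i.+1 = c' i.+1) -> contin x c j = contin x c' j.
Proof.
elim/ltn_ind: j => -[//|[//|[|j]]] IH cc.
  by rewrite !continSS /contin /= !mulr0.
rewrite [LHS]continSS [RHS]continSS cc// !IH// => i ij; apply: cc; lia.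
Qed.

(** Expansion of the tridiagonal determinant at its first row; [continSS] expands it at the last
    one. *)
Lemma contin_head x c j : contin x c j.+2 =
  x * contin x (fun i => c i.+1) j.+1
  - (-1) ^+ c 1 * contin x (fun i => c i.+2) j.
Proof.
elim/ltn_ind: j => -[_|[_|j IH]].
- by rewrite continSS /contin /= !mulr0.
- by rewrite !continSS /contin /=; ring.
rewrite continSS IH// IH// [contin x (fun i => c i.+1) j.+3]continSS.
by rewrite [contin x (fun i => c i.+2) j.+2]continSS; ring.
Qed.

(** Superposition. The homogeneous solution with data 1, 0 has the value - c_0 at index 2, so it is
    - c_0 times the continuant of the shifted signs. *)
Lemma duhamel x c f a b j : recur x c f a b j.+1 =
  contin x c j.+1 * b - (-1) ^+ c 0 * contin x (fun i => c i.+1) j * a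
  + recur x c f 0 0 j.+1.
Proof.
elim/ltn_ind: j => -[_|[_|j IH]].
- by rewrite /contin /=; ring.
- by rewrite /contin /=; ring.
rewrite [LHS]recurSS [recur x c f 0 0 _]recurSS IH// IH// [contin x c j.+3]continSS.
by rewrite [contin x (fun i => c i.+1) j.+2]continSS; ring.
Qed.

(** A discrete Wronskian of two homogeneous solutions: each step multiplies it by one sign. *)
Lemma contin_det x c j : contin x c j.+1 * contin x (fun i => c i.+1) j.+1
  - contin x c j.+2 * contin x (fun i => c i.+1) j = \prod_(i < j) (-1) ^+ c i.+1.
Proof.
elim: j => [|j IH]; first by rewrite big_ord0 /contin /=; ring.
rewrite big_ord_recr /= -IH [contin x c j.+3]continSS.
by rewrite [contin x (fun i => c i.+1) j.+2]continSS; ring.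
Qed.
End Recurrence.

Lemma second_order (T : Type) (a b : T) (h : nat -> T -> T -> T) :
  exists u : nat -> T,
    [/\ u 0 = a, u 1 = b & forall j, u j.+2 = h j (u j) (u j.+1)].
Proof.
pose p := fix p j := if j is j'.+1 then ((p j').2, h j' (p j').1 (p j').2)
  else (a, b).
by exists (fun j => (p j).1).
Qed.

Section Monodromy.
Variable A : comNzRingType.
Variables (n : nat) (c : int -> bool).
Hypothesis c_per : forall m, c (m + n.+1%:Z) = c m.
Variable x : A.
Implicit Types (phi f : int -> A).

(** (A_c - x) phi for an arbitrary function phi, without summability and over any commutative ring,
    so that x may also be an indeterminate. *)
Definition resid phi : int -> A :=
  fun m => (-1) ^+ c m * phi (m - 1) + phi (m + 1) - x * phi m.

Let sgn (m : int) (i : nat) : bool := c (m + 1 + i%:Z).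

Lemma sgn_shift m i : sgn m i.+1 = sgn (m + 1) i.
Proof. by rewrite /sgn; congr (c _); lia. Qed.

Lemma sgn_shiftE m : (fun i => sgn m i.+1) = sgn (m + 1).
Proof. by apply/funext => i; rewrite sgn_shift. Qed.

(* With Q_(j+1) (m) := - c_(m+1) K_j (m+1), the monodromy matrix carrying
   (phi (m+1), phi m) to (phi (m+n+2), phi (m+n+1)) is
   [[K_(n+2) (m), Q_(n+2) (m)], [K_(n+1) (m), Q_(n+1) (m)]]. *)
Definition trace_per m : A :=
  contin x (sgn m) n.+2 - (-1) ^+ c (m + 1) * contin x (sgn (m + 1)) n.

Definition det_per : A := \prod_(i < n.+1) (-1) ^+ c i%:Z.

Lemma int_shift_const (T : Type) (u : int -> T) :
  (forall m, u (m + 1) = u m) -> forall m, u m = u 0.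
Proof.
move=> uS; suff P : forall k : nat, u k%:Z = u 0 /\ u (- k%:Z) = u 0.
  by case=> k; [case: (P k)|rewrite NegzE; case: (P k.+1)].
elim=> [|k [IH1 IH2]]; first by rewrite oppr0.
split; first by rewrite -IH1 -[in RHS]uS; congr u; lia.
by rewrite -IH2 -[in LHS]uS; congr u; lia.
Qed.



(** Moving the base point conjugates the monodromy matrix. Concretely, K_(n+2) is expanded at its
    head for m and at its tail for m + 1; periodicity of [c] matches the terms. *)
Lemma trace_per_const m : trace_per m = trace_per 0.
Proof.
move: m; apply: int_shift_const => m.
rewrite /trace_per [contin x (sgn m) _]contin_head [contin x (sgn (m + 1)) _]continSS.
have -> : sgn (m + 1) n = c (m + 1) by rewrite /sgn -[RHS]c_per; congr c; lia.
have -> : sgn m 1 = c (m + 1 + 1) by rewrite sgn_shift /sgn addr0.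
have -> : (fun i => sgn m i.+2) = sgn (m + 1 + 1).
  by apply/funext => i; rewrite !sgn_shift.
by rewrite sgn_shiftE addrAC.
Qed.

Lemma det_per_const m : \prod_(i < n.+1) (-1) ^+ c (m + i%:Z) = det_per.
Proof.
transitivity (\prod_(i < n.+1) (-1) ^+ c (0 + i%:Z) : A); last first.
  by apply: eq_bigr => i _; rewrite add0r.
move: m; apply: int_shift_const => m.
rewrite big_ord_recr big_ord_recl /= mulrC addr0.
congr (_ * _); first by rewrite -[in RHS]c_per; congr (_ ^+ c _); lia.
by apply: eq_bigr => i _; congr (_ ^+ c _); rewrite /bump /=; lia.
Qed.

(* The value at m + j of the solution of (A_c - x) phi = f with
   phi m = phi (m + 1) = 0. *)
Definition block f (j : nat) m : A :=
  recur x (sgn m) (fun i => f (m + 1 + i%:Z)) 0 0 j.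

(** The operator B: what the forcing terms contribute to V - t + d V^-1 when the values at m and m +
    1 are computed from one period earlier. *)
Definition band f m : A := block f n.+1 m
  + contin x (sgn m) n.+1 * block f n.+2 (m - n.+1%:Z)
  - contin x (sgn m) n.+2 * block f n.+1 (m - n.+1%:Z).

Definition floquet phi m : A :=
  phi (m + n.+1%:Z) - trace_per 0 * phi m + det_per * phi (m - n.+1%:Z).

(** Every function solves the recurrence forced by its own residual. *)
Lemma resid_recur phi m j : phi (m + j%:Z) =
  recur x (sgn m) (fun i => resid phi (m + 1 + i%:Z)) (phi m) (phi (m + 1)) j.
Proof.
have := @recur_unique _ x (sgn m) (fun i => resid phi (m + 1 + i%:Z))
  (fun j => phi (m + j%:Z)).
rewrite addr0; apply => i; rewrite /resid /sgn.
rewrite (_ : m + 1 + i%:Z - 1 = m + i); last by lia.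
rewrite (_ : m + i.+2 = m + 1 + i%:Z + 1); last by lia.
by rewrite (_ : m + i.+1 = m + 1 + i%:Z); [ring | lia].
Qed.

Lemma resid_block phi m j : phi (m + j.+1%:Z) =
  contin x (sgn m) j.+1 * phi (m + 1)
  - (-1) ^+ c (m + 1) * contin x (sgn (m + 1)) j * phi m
  + block (resid phi) j.+1 m.
Proof. by rewrite resid_recur duhamel sgn_shiftE /sgn addr0. Qed.

Lemma sgn_per m : sgn (m - n.+1%:Z) = sgn m.
Proof. by apply/funext => i; rewrite /sgn -[LHS]c_per; congr c; lia. Qed.

(* Cayley-Hamilton for the monodromy matrix *)
Lemma band_resid phi : band (resid phi) = floquet phi.
Proof.
apply/funext => m; rewrite /floquet -(trace_per_const m).
have e1 := resid_block phi m n.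
have e2 := resid_block phi (m - n.+1%:Z) n.
have e3 := resid_block phi (m - n.+1%:Z) n.+1.
have ec : c (m - n.+1%:Z + 1) = c (m + 1) by rewrite -[LHS]c_per; congr c; lia.
have es : sgn (m - n.+1%:Z + 1) = sgn (m + 1).
  by rewrite -[RHS]sgn_per; congr sgn; lia.
rewrite sgn_per ec es in e2 e3.
rewrite (_ : m - n.+1%:Z + n.+1%:Z = m) in e2; last by lia.
rewrite (_ : m - n.+1%:Z + n.+2%:Z = m + 1) in e3; last by lia.
have := contin_det x (sgn m) n; rewrite sgn_shiftE => ed.
have ed' : det_per = (-1) ^+ c (m + 1) * \prod_(i < n) (-1) ^+ sgn m i.+1.
  rewrite -(det_per_const (m + 1)) big_ord_recl /= addr0; congr (_ * _).
rewrite /band /trace_per ed' -ed e1 e2 e3.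
ring.
Qed.

(** The shift by one period commutes with A_c because [c] is periodic. *)
Lemma resid_floquet phi : resid (floquet phi) = floquet (resid phi).
Proof.
apply/funext => m; rewrite /floquet /resid c_per.
have -> : c (m - n.+1%:Z) = c m by rewrite -[LHS]c_per; congr c; lia.
by rewrite (addrAC m 1) (addrAC m (-1) n.+1%:Z) (addrAC m 1) (addrAC m (-1)); ring.
Qed.

Lemma resid_solve f m0 a b :
  exists phi, [/\ resid phi = f, phi m0 = a & phi (m0 + 1) = b].
Proof.
have [v [v0 v1 vE]] := second_order b a
  (fun j y z => (-1) ^+ c (m0 - j%:Z) * (x * z - y + f (m0 - j%:Z))).
pose u := recur x (sgn m0) (fun i => f (m0 + 1 + i%:Z)) a b.
pose phi m := match m - m0 with Posz j => u j | Negz j => v j.+2 end.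
have phiu j : phi (m0 + j%:Z) = u j by rewrite /phi addrC addKr.
have phiv j : phi (m0 + 1 - j%:Z) = v j.
  case: j => [|[|j]]; first by rewrite subr0 (phiu 1) v0.
    by rewrite addrK -[m0]addr0 (phiu 0) v1.
  by rewrite /phi (_ : m0 + 1 - j.+2%:Z - m0 = Negz j) //; lia.
exists phi; split; last 2 first.
- by have := phiu 0; rewrite addr0.
- by rewrite (phiu 1).
apply/funext => m; rewrite /resid.
have [k [->|->]] : exists k : nat, m = m0 + k.+1%:Z \/ m = m0 - k%:Z.
  have [h|h] := leP m m0; first by exists `|m0 - m|%N; right; lia.
  by exists `|m - m0|.-1; left; lia.
- rewrite (_ : m0 + k.+1%:Z - 1 = m0 + k%:Z); last by lia.
  rewrite (_ : m0 + k.+1%:Z + 1 = m0 + k.+2%:Z); last by lia.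
  have -> : phi (m0 + k.+2%:Z) =
      x * u k.+1 - (-1) ^+ sgn m0 k * u k + f (m0 + 1 + k%:Z) by rewrite phiu.
  rewrite !phiu /sgn.
  by rewrite (_ : m0 + 1 + k%:Z = m0 + k.+1%:Z); [ring|lia].
- rewrite (_ : m0 - k%:Z - 1 = m0 + 1 - k.+2%:Z); last by lia.
  rewrite (_ : m0 - k%:Z + 1 = m0 + 1 - k%:Z); last by lia.
  have -> : phi (m0 - k%:Z) = v k.+1 by rewrite -phiv; congr phi; lia.
  by rewrite !phiv vE mulrA -expr2 sqrr_sign; ring.
Qed.

(** Every [f] is the residual of some phi, which reduces the claim to [band_resid] and
    [resid_floquet]. *)
Lemma resid_band f : resid (band f) = floquet f.
Proof.
have [phi [<- _ _]] := resid_solve f 0 0 0.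
by rewrite band_resid resid_floquet.
Qed.

Lemma recur00 (s : nat -> bool) j : recur x s (fun=> 0) 0 0 j = 0.
Proof.
have z i : (0 : A) = x * 0 - (-1) ^+ s i * 0 + 0 by ring.
exact/esym/(@recur_unique _ x s (fun=> 0) (fun=> 0) z j).
Qed.

Lemma band0 : band (fun=> 0) = fun=> 0.
Proof. by apply/funext => m; rewrite /band /block !recur00; ring. Qed.

End Monodromy.

(** * Periodicity of all solutions when the multipliers are roots of unity *)

Section RootOfUnity.
Variables (F : fieldType) (n : nat) (c : int -> bool).
Hypothesis c_per : forall m, c (m + n.+1%:Z) = c m.
Variables (x r1 r2 : F) (L : nat).
Hypotheses (r12 : r1 != r2) (r1L : r1 ^+ L = 1) (r2L : r2 ^+ L = 1).
Hypotheses (r1D : r1 + r2 = trace_per n c x 0) (r1M : r1 * r2 = det_per F n c).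

Lemma solution_periodic (phi : int -> F) m : resid c x phi = (fun=> 0) ->
  phi (m + (n.+1 * L)%N%:Z) = phi m.
Proof.
move=> phi0; have := band_resid c_per x phi; rewrite phi0 band0 => /esym fl.
pose y (j : nat) := phi (m + (n.+1 * j)%N%:Z).
have yE j : y j.+2 = (r1 + r2) * y j.+1 - r1 * r2 * y j.
  apply/eqP; rewrite -subr_eq0 r1D r1M.
  rewrite -[X in _ == X](congr1 (@^~ (m + (n.+1 * j.+1)%N%:Z)) fl).
  rewrite /y /floquet.
  rewrite (_ : m + (n.+1 * j.+1)%N%:Z + n.+1%:Z = m + (n.+1 * j.+2)%N%:Z); last by lia.
  rewrite (_ : m + (n.+1 * j.+1)%N%:Z - n.+1%:Z = m + (n.+1 * j)%N%:Z); last by lia.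
  by apply/eqP; ring.
(* Along steps of one period a solution obeys a recursion with constant coefficients and
   characteristic roots [r1], [r2]. This is its closed form, cleared of the denominator r1 - r2. *)
have yj j : (r1 - r2) * y j = r1 ^+ j * (y 1 - r2 * y 0) - r2 ^+ j * (y 1 - r1 * y 0)
  /\ (r1 - r2) * y j.+1 =
      r1 ^+ j.+1 * (y 1 - r2 * y 0) - r2 ^+ j.+1 * (y 1 - r1 * y 0).
  elim: j => [|j [IH1 IH2]]; first by rewrite !expr1 !expr0; split; ring.
  split=> //; rewrite yE mulrBr mulrCA IH2 (mulrCA _ (r1 * r2)) IH1 !exprS; ring.
have /(mulfI _) : (r1 - r2) * y L = (r1 - r2) * y 0.
  by rewrite (yj L).1 r1L r2L; ring.
by rewrite subr_eq0 => /(_ r12); rewrite /y muln0 addr0.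
Qed.

(** The continuants are the solution with values 0 and 1 at 0 and 1; by periodicity it returns to
    0. *)
Lemma contin_periodic_eq0 : contin x (fun i => c i.+1%:Z) (n.+1 * L)%N = 0.
Proof.
have [phi [phiE phi0 phi1]] := resid_solve c x (fun=> 0) 0 0 1.
have := solution_periodic 0 phiE; rewrite (resid_recur c x) phiE phi0 phi1 => <-.
apply: eq_recur => // i _; congr c; lia.
Qed.
End RootOfUnity.

(** * The resolvent of a periodic operator *)

Section SquareSummable.
Variable R : realType.
Implicit Types (f g phi : int -> Cplx R) (q : R[i]).

Lemma sqr_normc_Re_Im (z : R[i]) : normc z ^+ 2 = complex.Re z ^+ 2 + complex.Im z ^+ 2.
Proof. by case: z => a b /=; rewrite sqr_sqrtr// addr_ge0 ?sqr_ge0. Qed.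

Lemma normc_sign (b : bool) : normc ((-1) ^+ b : R[i]) = 1.
Proof. by case: b; rewrite ?expr1 ?expr0 ?normcN normc1. Qed.

Lemma normcX (z : R[i]) k : normc (z ^+ k) = normc z ^+ k.
Proof. by elim: k => [|k IH]; rewrite ?expr0 ?normc1// !exprS normcM IH. Qed.

Lemma sqsum_term f m : ((normc (f m) ^+ 2)%:E <= sqsum f)%E.
Proof.
apply: esum_ge; exists [set m]; first by split.
by rewrite fsbig_set1.
Qed.

Lemma sqsum_eq0 f : sqsum f = 0%E -> f = fun=> 0.
Proof.
move=> f0; apply/funext => m; have := sqsum_term f m.
rewrite f0 lee_fin => h; apply: eq0_normc; apply/eqP.
by rewrite -sqrf_eq0 eq_le h sqr_ge0.
Qed.

Lemma sqsum_le2 (M N : R) f g phi : 0 <= M -> 0 <= N ->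
  (forall m, normc (phi m) ^+ 2 <=
             M * normc (f m) ^+ 2 + N * normc (g m) ^+ 2) ->
  (sqsum phi <= M%:E * sqsum f + N%:E * sqsum g)%E.
Proof.
move=> M0 N0 h.
apply: (@le_trans _ _ (\esum_(m in [set: int])
  ((M * normc (f m) ^+ 2)%:E + (N * normc (g m) ^+ 2)%:E))%E).
  by apply: le_esum => m _; rewrite -EFinD lee_fin.
rewrite esumD; last 2 first.
- by move=> m _; rewrite lee_fin mulr_ge0// sqr_ge0.
- by move=> m _; rewrite lee_fin mulr_ge0// sqr_ge0.
by apply: leeD; apply: esumZ_le => // m; rewrite sqr_ge0.
Qed.

Lemma sqsumZ_le (M : R) f phi : 0 <= M ->
  (forall m, normc (phi m) ^+ 2 <= M * normc (f m) ^+ 2) ->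
  (sqsum phi <= M%:E * sqsum f)%E.
Proof.
move=> M0 h; rewrite -[leRHS]adde0 -(mul0e (sqsum f)).
by apply: sqsum_le2 => // m; rewrite mul0r addr0.
Qed.

(** The bound is an inequality between extended reals for all functions, so compositions carry no
    summability side conditions. *)
Definition sqbounded (X : (int -> Cplx R) -> int -> Cplx R) :=
  exists2 M : R, 0 <= M & forall f, (sqsum (X f) <= M%:E * sqsum f)%E.

Lemma sqbounded_id : sqbounded id.
Proof. by exists 1 => // f; rewrite mul1e. Qed.

Lemma sqbounded0 : sqbounded (fun _ _ => 0).
Proof.
by exists 0 => // f; apply: sqsumZ_le => // m; rewrite mul0r normc0 expr0n.
Qed.

Lemma sqboundedD X Y : sqbounded X -> sqbounded Y ->
  sqbounded (fun f m => X f m + Y f m).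
Proof.
move=> [M M0 XM] [N N0 YN]; exists (2 * M + 2 * N) => [|f].
  by rewrite addr_ge0 ?mulr_ge0.
apply: (le_trans (sqsum_le (ler0n _ 2) _)) => [m|]; first exact: sqr_normcD_le.
rewrite [(2 * M + 2 * N)%:E]EFinD ge0_muleDl ?lee_fin ?mulr_ge0//.
rewrite (EFinM 2 M) (EFinM 2 N) -!muleA.
by apply: leeD; apply: lee_wpmul2l; rewrite ?lee_fin.
Qed.

Lemma sqboundedM (w : int -> R[i]) (K : R) X : (forall m, normc (w m) <= K) ->
  sqbounded X -> sqbounded (fun f m => w m * X f m).
Proof.
move=> wK [M M0 XM]; exists (K ^+ 2 * M) => [|f].
  by rewrite mulr_ge0 ?sqr_ge0.
apply: (@le_trans _ _ ((K ^+ 2)%:E * sqsum (X f))%E).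
  apply: sqsumZ_le => [|m]; first exact: sqr_ge0.
  rewrite normcM exprMn ler_wpM2r ?sqr_ge0// ler_sqr ?nnegrE ?normc_ge0//.
  exact: le_trans (normc_ge0 _) (wK m).
by rewrite (EFinM (K ^+ 2)) -muleA lee_wpmul2l// lee_fin sqr_ge0.
Qed.

Lemma sqbounded_shift a X : sqbounded X -> sqbounded (fun f m => X f (m + a)).
Proof. by move=> [M M0 XM]; exists M => // f; rewrite (sqsum_shift a (X f)). Qed.

Lemma sqbounded_block (c : int -> bool) (x : R[i]) j :
  sqbounded (block c x ^~ j).
Proof.
elim/ltn_ind: j => -[_|[_|j IH]]; try exact: sqbounded0.
have -> : (block c x)^~ j.+2 = fun f m => (fun=> x) m * block c x f j.+1 m +
   ((- (-1) ^+ c (m + 1 + j%:Z)) * block c x f j m + f (m + (1 + j%:Z))).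
  apply/funext => f; apply/funext => m; rewrite !addrA mulNr.
  by rewrite /block recurSS.
apply: sqboundedD; first by apply: (@sqboundedM _ (normc x)) => //; exact: IH.
apply: sqboundedD; last exact: (sqbounded_shift _ sqbounded_id).
apply: (@sqboundedM _ 1); last by apply: IH; lia.
by move=> m; rewrite normcN normc_sign.
Qed.

(** Uniformity in the signs is the point: the coefficients of [band] are continuants whose signs
    vary with m. *)
Lemma contin_bounded (x : R[i]) j : exists K : R, forall s : nat -> bool,
  normc (contin x s j) <= K.
Proof.
elim/ltn_ind: j => -[_|[_|j IH]].
- by exists 0 => s; rewrite [normc _]normc0.
- by exists 1 => s; rewrite [normc _]normc1.
have [K hK] := IH j.+1 (leqnn _); have [K' hK'] := IH j (leqnSn _).
exists (normc x * K + K') => s; rewrite continSS.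
apply: le_trans (le_normcD _ _) _; rewrite normcN !normcM normc_sign mul1r.
by apply: lerD => //; rewrite ler_wpM2l// normc_ge0.
Qed.

Lemma sqbounded_band n c (x : R[i]) : sqbounded (band n c x).
Proof.
have [K hK] := contin_bounded x n.+1; have [K' hK'] := contin_bounded x n.+2.
pose s m := fun i : nat => c (m + 1 + i%:Z).
have -> : band n c x = fun f m => block c x f n.+1 m +
   (contin x (s m) n.+1 * block c x f n.+2 (m + - n.+1%:Z)
   + - contin x (s m) n.+2 * block c x f n.+1 (m + - n.+1%:Z)).
  by apply/funext => f; apply/funext => m; rewrite mulNr addrA.
apply: sqboundedD; first exact: sqbounded_block.
apply: sqboundedD.
  by apply: (@sqboundedM _ K) => //; exact: (sqbounded_shift _ (sqbounded_block _ _ _)).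
apply: (@sqboundedM _ K'); first by move=> m; rewrite normcN.
exact: (sqbounded_shift _ (sqbounded_block _ _ _)).
Qed.

(** Convexity of the square with weights |q| and 1 - |q|. The coefficient of the first term stays
    below 1, so the bound can be iterated. *)
Lemma sqr_normc_convex q (y z : R[i]) : normc q < 1 ->
  normc (q * y + z) ^+ 2 <=
  normc q * normc y ^+ 2 + (1 - normc q)^-1 * normc z ^+ 2.
Proof.
move=> q1; have r0 := normc_ge0 q.
have d0 : 0 < 1 - normc q by rewrite subr_gt0.
apply: (@le_trans _ _ ((normc q * normc y + normc z) ^+ 2)).
  rewrite ler_sqr ?nnegrE ?addr_ge0 ?mulr_ge0 ?normc_ge0//.
  by rewrite -normcM le_normcD.
move: (normc y) (normc z) (normc q) r0 d0 => u v r r0 d0.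
rewrite -subr_ge0.
have -> : r * u ^+ 2 + (1 - r)^-1 * v ^+ 2 - (r * u + v) ^+ 2 =
    r / (1 - r) * ((1 - r) * u - v) ^+ 2 by field; lra.
by rewrite mulr_ge0 ?sqr_ge0// divr_ge0// ltW.
Qed.

(** Partial sums of the Neumann series for (1 - q V^a)^-1 f, written as iterates of psi = q V^a psi
    + f. *)
Fixpoint picard q a f (j : nat) : int -> Cplx R :=
  if j is j'.+1 then fun m => q * picard q a f j' (m + a) + f m else fun=> 0.

(** The constant (1 - |q|)^-2 is the fixed point of K = |q| K + (1 - |q|)^-1, hence is preserved by
    each iteration. *)
Lemma sqsum_picard q a f j : normc q < 1 ->
  (sqsum (picard q a f j) <= ((1 - normc q) ^- 2)%:E * sqsum f)%E.
Proof.
move=> q1; have d0 : 0 < 1 - normc q by rewrite subr_gt0.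
have r0 := normc_ge0 q.
elim: j => [|j IH] /=.
  rewrite [sqsum _](_ : _ = 0%E); last first.
    by apply: esum1 => m _; rewrite normc0 expr0n.
  by rewrite mule_ge0 ?sqsum_ge0// lee_fin invr_ge0 sqr_ge0.
have h := @sqsum_le2 (normc q) (1 - normc q)^-1
  (fun m => picard q a f j (m + a)) f
  (fun m => q * picard q a f j (m + a) + f m).
apply: le_trans (h _ _ _) _ => //; first by rewrite invr_ge0 ltW.
  by move=> m; exact: sqr_normc_convex.
rewrite (sqsum_shift a).
apply: (@le_trans _ _ ((normc q)%:E * (((1 - normc q) ^- 2)%:E * sqsum f)
   + (1 - normc q)^-1%:E * sqsum f)%E).
  by apply: leeD => //; apply: lee_wpmul2l; rewrite ?lee_fin.
rewrite muleA -EFinM -ge0_muleDl; last 2 first.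
- by rewrite lee_fin mulr_ge0// invr_ge0 sqr_ge0.
- by rewrite lee_fin invr_ge0 ltW.
apply: lee_wpmul2r; first exact: sqsum_ge0.
rewrite -EFinD lee_fin le_eqVlt; apply/orP; left; apply/eqP.
by field; lra.
Qed.
End SquareSummable.

(** * Inversion of 1 - q V^a by Neumann series *)

Section Neumann.
Variable R : realType.
Implicit Types (f g phi psi : int -> Cplx R) (q : R[i]).

Lemma picardE q a f j m :
  picard q a f j m = \sum_(k < j) q ^+ k * f (m + a *+ k) :> R[i].
Proof.
elim: j m => [|j IH] m; first by rewrite big_ord0.
rewrite /= IH big_ord_recl expr0 mul1r addr0 addrC; congr (_ + _).
by rewrite mulr_sumr; apply: eq_bigr => k _; rewrite mulrA -exprS mulrS addrA.
Qed.

Lemma normc_le_sqsum f m : (sqsum f < +oo)%E ->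
  normc (f m) <= Num.sqrt (fine (sqsum f)).
Proof.
move=> foo; rewrite -[leLHS]ger0_norm ?normc_ge0// -sqrtr_sqr ler_wsqrtr//.
rewrite -lee_fin fineK ?sqsum_term// sqsum_fin//.
Qed.

(** Comparison with a geometric series. [p] stands for the real or the imaginary part, so that only
    limits in [R] are taken. *)
Lemma picard_is_cvg q a f m (p : R[i] -> R) : normc q < 1 ->
  (sqsum f < +oo)%E -> {morph p : x y / x + y} -> p 0 = 0 ->
  (forall z, `|p z| <= normc z) ->
  cvgn (fun j => p (picard q a f j m)).
Proof.
move=> q1 foo pD p0 pn; pose u k := p (q ^+ k * f (m + a *+ k)).
have -> : (fun j => p (picard q a f j m)) = series u.
  by apply/funext => j; rewrite picardE (big_morph p pD p0) /series /= big_mkord.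
apply: normed_cvg; pose B := Num.sqrt (fine (sqsum f)).
apply: (@series_le_cvg _ _ (geometric B (normc q))) => [k|k|k|].
- exact: normr_ge0.
- by rewrite mulr_ge0 ?sqrtr_ge0 ?exprn_ge0 ?normc_ge0.
- apply: (le_trans (pn _)); rewrite normcM normcX /= mulrC.
  by rewrite ler_wpM2r ?exprn_ge0 ?normc_ge0// normc_le_sqsum.
- by apply: is_cvg_geometric_series; rewrite ger0_norm ?normc_ge0.
Qed.

Lemma normr_Re_le (z : R[i]) : `|complex.Re z| <= normc z.
Proof.
rewrite -[leRHS]ger0_norm ?normc_ge0// -ler_sqr ?nnegrE ?normr_ge0//.
by rewrite !real_normK ?num_real// sqr_normc_Re_Im lerDl sqr_ge0.
Qed.

Lemma normr_Im_le (z : R[i]) : `|complex.Im z| <= normc z.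
Proof.
rewrite -[leRHS]ger0_norm ?normc_ge0// -ler_sqr ?nnegrE ?normr_ge0//.
by rewrite !real_normK ?num_real// sqr_normc_Re_Im lerDr sqr_ge0.
Qed.

Lemma Re_affine (x y z : R[i]) : complex.Re (x * y + z) =
  complex.Re x * complex.Re y - complex.Im x * complex.Im y + complex.Re z.
Proof. by case: x y z => ? ? [? ?] []. Qed.

Lemma Im_affine (x y z : R[i]) : complex.Im (x * y + z) =
  complex.Re x * complex.Im y + complex.Im x * complex.Re y + complex.Im z.
Proof. by case: x y z => ? ? [? ?] []. Qed.

Lemma cvg_sqr (u : nat -> R) (l : R) :
  u @ \oo --> l -> (fun j => u j ^+ 2) @ \oo --> l ^+ 2.
Proof. by move=> ul; rewrite expr2; apply: cvgM. Qed.

Lemma neumann_solve q a f : normc q < 1 -> (sqsum f < +oo)%E ->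
  exists psi, [/\ forall m, psi m = q * psi (m + a) + f m &
    (sqsum psi <= ((1 - normc q) ^- 2)%:E * sqsum f)%E].
Proof.
move=> q1 foo.
have cRe m : cvgn (fun j => complex.Re (picard q a f j m)).
  apply: picard_is_cvg => //; first by case=> ? ? [].
  exact: normr_Re_le.
have cIm m : cvgn (fun j => complex.Im (picard q a f j m)).
  apply: picard_is_cvg => //; first by case=> ? ? [].
  exact: normr_Im_le.
pose re m := limn (fun j => complex.Re (picard q a f j m)).
pose im m := limn (fun j => complex.Im (picard q a f j m)).
exists (fun m => Complex (re m) (im m)); split.
  move=> m; apply/eqP; rewrite eq_complex; apply/andP; split; apply/eqP.
    have h1 : (fun j => complex.Re (picard q a f j.+1 m)) @ \oo --> re m.
      move: (cRe m); rewrite /re.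
      by rewrite -(cvg_shiftS (fun j => complex.Re (picard q a f j m))).
    apply: (cvg_unique _ h1) => //.
    have -> : (fun j => complex.Re (picard q a f j.+1 m)) = fun j =>
      complex.Re q * complex.Re (picard q a f j (m + a))
      - complex.Im q * complex.Im (picard q a f j (m + a)) + complex.Re (f m).
      by apply/funext => j; exact: Re_affine.
    have -> : complex.Re (q * Complex (re (m + a)) (im (m + a)) + f m) =
      complex.Re q * re (m + a) - complex.Im q * im (m + a) + complex.Re (f m).
      exact: Re_affine.
    apply: cvgD; last exact: cvg_cst.
    by apply: cvgB; apply: cvgZr; [exact: cRe|exact: cIm].
  have h1 : (fun j => complex.Im (picard q a f j.+1 m)) @ \oo --> im m.
    move: (cIm m); rewrite /im.
    by rewrite -(cvg_shiftS (fun j => complex.Im (picard q a f j m))).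
  apply: (cvg_unique _ h1) => //.
  have -> : (fun j => complex.Im (picard q a f j.+1 m)) = fun j =>
    complex.Re q * complex.Im (picard q a f j (m + a))
    + complex.Im q * complex.Re (picard q a f j (m + a)) + complex.Im (f m).
    by apply/funext => j; exact: Im_affine.
  have -> : complex.Im (q * Complex (re (m + a)) (im (m + a)) + f m) =
    complex.Re q * im (m + a) + complex.Im q * re (m + a) + complex.Im (f m).
    exact: Im_affine.
  apply: cvgD; last exact: cvg_cst.
  by apply: cvgD; apply: cvgZr; [exact: cIm|exact: cRe].
pose K := (1 - normc q) ^- 2.
have bound j := sqsum_picard a f j q1.
have Kfin : (K%:E * sqsum f)%E \is a fin_num.
  by rewrite fin_numM// sqsum_fin.
(* As in Fatou's lemma: the uniform bound on the iterates passes to the limit in every finite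
   partial sum. *)
apply: ge_ereal_sup => _ [X [finX _]] <-.
rewrite fsbig_finite//= sumEFin -(fineK Kfin) lee_fin.
have cvX : (fun j => \sum_(m <- finmap.enum_fset (fset_set X))
      normc (picard q a f j m) ^+ 2) @ \oo -->
    \sum_(m <- finmap.enum_fset (fset_set X)) normc (Complex (re m) (im m)) ^+ 2.
  elim: (finmap.enum_fset (fset_set X)) => [|m s IH].
    by under eq_fun do rewrite big_nil; rewrite big_nil; exact: cvg_cst.
  rewrite big_cons; under eq_fun do rewrite big_cons.
  apply: cvgD => //; rewrite [in X in _ --> X]sqr_normc_Re_Im.
  under eq_fun do rewrite sqr_normc_Re_Im.
  by apply: cvgD; apply: cvg_sqr; [exact: cRe|exact: cIm].
rewrite -(cvg_lim _ cvX)//; apply: limr_le; first by apply: cvgP; exact: cvX.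
near=> j; rewrite -lee_fin fineK//; apply: le_trans (bound j).
apply: esum_ge; exists X => //.
by rewrite fsbig_finite//= sumEFin.
Unshelve. all: by end_near.
Qed.

(** The equation bounds the square sum of psi by |q|^2 times itself, and it is finite. *)
Lemma neumann_inj q a psi : normc q < 1 -> (sqsum psi < +oo)%E ->
  (forall m, psi m = q * psi (m + a)) -> psi = fun=> 0.
Proof.
move=> q1 poo pE; apply: sqsum_eq0.
have h : (sqsum psi <= (normc q ^+ 2)%:E * sqsum psi)%E.
  rewrite -[X in (_ <= _ * X)%E](sqsum_shift a).
  apply: sqsumZ_le => [|m]; first exact: sqr_ge0.
  by rewrite {1}pE normcM exprMn.
have pf : sqsum psi \is a fin_num by rewrite sqsum_fin.
have p0 := sqsum_ge0 psi.
move: h p0; rewrite -(fineK pf) -EFinM !lee_fin => h p0; congr EFin.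
apply/eqP; rewrite eq_le p0 andbT.
have q2 : normc q ^+ 2 < 1 by rewrite expr_lt1 ?normc_ge0.
rewrite leNgt; apply/negP => p1; move: h; rewrite leNgt => /negP; apply.
by rewrite gtr_pMl.
Qed.
End Neumann.

Lemma floquetB (A : comNzRingType) n c (x : A) (phi psi : int -> A) :
  floquet n c x (fun m => phi m - psi m) =
  fun m => floquet n c x phi m - floquet n c x psi m.
Proof. by apply/funext => m; rewrite /floquet; ring. Qed.

(** * The resolvent off the unimodular discriminant condition *)

Section Resolvent.
Variable R : realType.
Implicit Types (f g phi psi : int -> Cplx R).

Lemma hop_resid c (lambda : Cplx R) (phi : ell2 R) m :
  (hop c phi - lambda *: phi) m = resid c lambda phi m.
Proof. by []. Qed.

Lemma sqsum_ltoo (phi : ell2 R) : (sqsum phi < +oo)%E.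
Proof. by case: phi => phi /=; rewrite inE. Qed.

(** Solutions may be chosen arbitrarily: injectivity makes the choice unique, hence linear. *)
Lemma notin_spec (T : {linear ell2 R -> ell2 R}) (lambda : Cplx R) (C : R) :
  (forall phi : ell2 R, T phi - lambda *: phi = 0 -> phi = 0) ->
  0 <= C ->
  (forall f : ell2 R, exists phi : ell2 R,
     T phi - lambda *: phi = f /\ (sqsum phi <= C%:E * sqsum f)%E) ->
  ~ spec T lambda.
Proof.
move=> inj C0 /choice[S hS]; apply.
have TD a u v : T (a *: u + v) - lambda *: (a *: u + v) =
    a *: (T u - lambda *: u) + (T v - lambda *: v).
  by rewrite linearP scalerDr scalerBr !scalerA (mulrC lambda) opprD addrACA.
have inj2 u v : T u - lambda *: u = T v - lambda *: v -> u = v.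
  move=> uv; apply/eqP; rewrite -subr_eq0; apply/eqP; apply: inj.
  have := TD (-1) v u; rewrite !scaleN1r uv addNr => <-.
  by rewrite (addrC u).
have lin : linear S.
  by move=> a u v; apply: inj2; rewrite TD !(hS _).1.
pose SL : {linear ell2 R -> ell2 R} :=
  HB.pack S (GRing.isLinear.Build _ _ _ _ S lin).
exists SL; split => [|phi|phi]; last 2 first.
- by apply: inj2; rewrite /= (hS _).1.
- by rewrite /= (hS _).1.
exists (Num.sqrt C) => phi /=; rewrite /l2norm -sqrtrM// ler_wsqrtr//.
have f1 := sqsum_fin (valP phi); have f2 := sqsum_fin (valP (S phi)).
by rewrite -lee_fin EFinM !fineK// (hS _).2.
Qed.

Variables (n : nat) (c : int -> bool).
Hypothesis c_per : forall m, c (m + n.+1%:Z) = c m.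
Variables (lambda r1 r2 : R[i]).
Hypotheses (r1D : r1 + r2 = trace_per n c lambda 0).
Hypotheses (r1M : r1 * r2 = det_per R[i] n c).
Hypotheses (r1_lt1 : normc r1 < 1) (r2_gt1 : 1 < normc r2).

Let r2_neq0 : r2 != 0.
Proof. by apply: contraTneq r2_gt1 => ->; rewrite [normc _]normc0 ltNge ler01. Qed.

Let r2V_lt1 : normc r2^-1 < 1.
Proof. by rewrite normcV invf_lt1 // (lt_trans _ r2_gt1). Qed.

(* V - t + d V^-1 = - r2 (1 - r1 V^-1) (1 - r2^-1 V), V the shift by n + 1 *)
Lemma floquet_factor psi g m :
  (forall k, g k = psi k - r2^-1 * psi (k + n.+1%:Z)) ->
  floquet n c lambda psi m = - r2 * (g m - r1 * g (m - n.+1%:Z)).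
Proof.
move=> gE; rewrite /floquet -r1D -r1M !gE subrK.
by field.
Qed.

(** The scalar - r2 and the two factors of [floquet_factor] are inverted in turn, the factors by
    Neumann series in V^-1 and V. *)
Lemma floquet_solve : exists2 K : R, 0 <= K & forall f, (sqsum f < +oo)%E ->
  exists2 psi, floquet n c lambda psi = f & (sqsum psi <= K%:E * sqsum f)%E.
Proof.
pose K1 := (1 - normc r1) ^- 2; pose K2 := (1 - normc r2^-1) ^- 2.
pose K3 := normc r2^-1 ^+ 2.
have K10 : 0 <= K1 by rewrite invr_ge0 sqr_ge0.
have K20 : 0 <= K2 by rewrite invr_ge0 sqr_ge0.
have K30 : 0 <= K3 by rewrite sqr_ge0.
exists (K2 * (K1 * K3)) => [|f foo]; first by do 2?apply: mulr_ge0.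
pose h m : Cplx R := - r2^-1 * f m.
have hh : (sqsum h <= K3%:E * sqsum f)%E.
  by apply: sqsumZ_le => // m; rewrite normcM normcN exprMn.
have lt_oo (K : R) u v : (sqsum u < +oo)%E ->
    (sqsum v <= K%:E * sqsum u)%E -> (sqsum v < +oo)%E.
  move=> uoo /le_lt_trans; apply.
  by rewrite ltey_eq fin_numM// sqsum_fin.
have [g [gE gb]] := neumann_solve (- n.+1%:Z) r1_lt1 (lt_oo _ _ _ foo hh).
have goo := lt_oo _ _ _ (lt_oo _ _ _ foo hh) gb.
have [psi [pE pb]] := neumann_solve n.+1%:Z r2V_lt1 goo.
exists psi; last first.
  apply: (le_trans pb); rewrite 2!EFinM -!muleA; apply: lee_wpmul2l => //.
  by apply: (le_trans gb); apply: lee_wpmul2l.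
apply/funext => m; rewrite (@floquet_factor psi g) => [|k].
  by rewrite [g m]gE /h; field.
by rewrite [psi k]pE; ring.
Qed.

Lemma floquet_inj psi : (sqsum psi < +oo)%E ->
  floquet n c lambda psi = (fun=> 0) -> psi = fun=> 0.
Proof.
move=> poo p0; pose g k : Cplx R := psi k - r2^-1 * psi (k + n.+1%:Z).
have g0 : g = fun=> 0.
  apply: (neumann_inj (a := - n.+1%:Z) r1_lt1).
    have [M M0] : sqbounded (fun u k => u k + (- r2^-1) * u (k + n.+1%:Z) : Cplx R).
      apply: sqboundedD; first exact: sqbounded_id.
      apply: (@sqboundedM _ _ (normc (- r2^-1))) => //.
      exact: (sqbounded_shift _ (sqbounded_id _)).
    move=> /(_ psi); rewrite (_ : (fun k => _) = g); last first.
      by apply/funext => k; rewrite mulNr.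
    move=> /le_lt_trans; apply.
    by rewrite ltey_eq fin_numM// sqsum_fin.
  move=> m; have := floquet_factor (psi := psi) (g := g) m (fun=> erefl).
  rewrite p0 => /esym/eqP; rewrite mulf_eq0 oppr_eq0 (negbTE r2_neq0) /=.
  by rewrite subr_eq0 => /eqP.
apply: (neumann_inj (a := n.+1%:Z) r2V_lt1) => // m.
by apply/eqP; rewrite -subr_eq0 -[X in X == _]/(g m) g0.
Qed.

Lemma notin_spec_hop : ~ spec (hop c : {linear ell2 R -> ell2 R}) lambda.
Proof.
have [K K0 solve] := floquet_solve.
have [M M0 band_le] := sqbounded_band n c lambda.
apply: (@notin_spec _ _ (K * M)); last 1 first.
- move=> f; pose b := band n c lambda f.
  have boo : (sqsum b < +oo)%E.
    apply: (le_lt_trans (band_le f)).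
    by rewrite ltey_eq fin_numM// sqsum_fin// inE sqsum_ltoo.
  have [psi psiE psib] := solve b boo.
  have psioo : psi \in @sqsummable R.
    rewrite inE; apply: (le_lt_trans psib).
    by rewrite ltey_eq fin_numM// sqsum_fin.
  exists (Ell2 psioo); split; last first.
    apply: (le_trans psib); rewrite EFinM -muleA; apply: lee_wpmul2l => //.
    exact: band_le.
  (* The solution is (V - t + d V^-1)^-1 B f. Its residual minus f is killed by V - t + d V^-1,
     since both operators commute with A_c - x, and so vanishes by injectivity. *)
  apply/eqP; rewrite -subr_eq0; apply/eqP/val_inj.
  set d : ell2 R := _ - f.
  apply: floquet_inj; first exact: sqsum_ltoo.
  have -> : val d = fun k => resid c lambda psi k - val f k by [].
  rewrite floquetB -(resid_floquet c_per) psiE resid_band //.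
  by apply/funext => k; rewrite subrr.
- move=> phi phi0; apply/val_inj; apply: floquet_inj; first exact: sqsum_ltoo.
  rewrite -(band_resid c_per) [resid _ _ _](_ : _ = fun=> 0) ?band0//.
  by apply/funext => m; rewrite -hop_resid phi0.
- by rewrite mulr_ge0.
Qed.
End Resolvent.

(** * Finite matrices and their periodic extensions *)

(** [eigenvalue] refers to row vectors; the transpose gives access to column eigenvectors. *)
Lemma eigenvalue_trmx (F : fieldType) n (A : 'M[F]_n) (a : F) :
  eigenvalue A^T a = eigenvalue A a.
Proof.
rewrite /eigenvalue /eigenspace -!mxrank_eq0 !mxrank_ker.
by rewrite -[X in (n - X)%N]mxrank_tr raddfB /= trmxK tr_scalar_mx.
Qed.

Section FiniteMatrix.
Variable R : realType.

Lemma A_fin_mul n (k : n.-tuple bool) (u : nat -> R[i]) (i : 'I_n) :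
  ((\row_j u j) *m (A_fin R k)^T) 0 i =
  (if (i.+1 < n)%N then u i.+1 else 0) +
  (if (0 < i)%N then (-1) ^+ nth false k i.-1 * u i.-1 else 0).
Proof.
rewrite mxE (eq_bigr (fun j : 'I_n => (if j == i.+1 :> nat then u j else 0) +
   if j == i.-1 :> nat then
     (if (0 < i)%N then (-1) ^+ nth false k i.-1 * u i.-1 else 0) else 0)).
  rewrite big_split -!big_mkcond /=.
  rewrite (big_ord1_eq _ u) (big_ord1_eq _ (fun=> _)).
  by rewrite (leq_ltn_trans (leq_pred i) (ltn_ord i)).
move=> j _; rewrite !mxE.
have [->|ij] := eqVneq (j : nat) i.+1.
  by rewrite mulr1 ifF ?addr0//; apply/eqP; lia.
have [->|ji] := eqVneq (i : nat) j.+1.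
  by rewrite /= eqxx add0r mulrC.
rewrite mulr0 add0r; case: eqP => // e; case: ifP => // i0.
by exfalso; move: ji; rewrite e prednK// eqxx.
Qed.

(** Row by row the eigenvector equation is the recursion of the continuants: up to a scalar the
    entries are K_1, K_2, and so on, and the last row requires the next continuant to vanish. *)
Lemma eigenvalue_A_fin n (k : n.+1.-tuple bool) (lambda : R[i]) :
  eigenvalue (A_fin R k) lambda =
  (contin lambda (fun i => nth false k i.-1) n.+2 == 0).
Proof.
rewrite -eigenvalue_trmx; set s := fun i => nth false k i.-1.
apply/eigenvalueP/eqP => [[v vE v0]|K0]; last first.
  exists (\row_j contin lambda s j.+1); last first.
    apply/eqP => /rowP /(_ 0); rewrite !mxE /= => /eqP.
    by rewrite [contin _ _ _]/(1 : R[i]) oner_eq0.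
  apply/rowP => i; rewrite (A_fin_mul k (fun j => contin lambda s j.+1)) !mxE.
  have -> : (if (i.+1 < n.+1)%N then contin lambda s i.+2 else 0) =
      contin lambda s i.+2.
    case: ltnP => // h; rewrite (_ : (i : nat) = n) ?K0//.
    by move: (ltn_ord i); lia.
  rewrite continSS; case: (nat_of_ord i) => [|i'] /=; last by rewrite subrK.
  by rewrite [contin _ _ 0]/(0 : R[i]) mulr0 subr0 addr0.
(* Extension by zero past the matrix turns the last row into one more instance of the recursion. *)
pose u j := if (j < n.+1)%N then v 0 (inord j) else 0.
have vu : v = \row_j u j.
  by apply/rowP => j; rewrite !mxE /u ltn_ord inord_val.
have uE i : (i < n.+1)%N -> u i.+1 = lambda * u i
    - (if (0 < i)%N then (-1) ^+ nth false k i.-1 * u i.-1 else 0).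
  move=> ilt; move/rowP: vE => /(_ (Ordinal ilt)).
  rewrite {1}vu A_fin_mul !mxE /= => e.
  rewrite {2}/u ilt (_ : inord i = Ordinal ilt); last first.
    by apply/val_inj; rewrite /= inordK.
  by rewrite -e addrK /u; case: ifP.
have uK i : (i <= n.+1)%N -> u i = u 0 * contin lambda s i.+1.
  elim/ltn_ind: i => -[_ _|[_ _|i IH ilt]].
  - by rewrite [contin _ _ _]/(1 : R[i]) mulr1.
  - by rewrite uE// continSS /contin /= subr0 mulr0 subr0 mulr1 mulrC.
  rewrite uE// /= IH//; last by lia.
  by rewrite [u i]IH//; [rewrite [contin _ _ i.+3]continSS; ring | lia].
have : u 0 * contin lambda s n.+2 = 0 by rewrite -uK// /u ltnn.
move/eqP; rewrite mulf_eq0 => /orP[/eqP u0|/eqP//].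
case/eqP: v0; rewrite vu; apply/rowP => j; rewrite !mxE uK ?u0 ?mul0r//.
exact: ltnW (ltn_ord j).
Qed.
End FiniteMatrix.

(** * Spectrum from a solution of periodic modulus *)

Section PeriodicSolution.
Variable R : realType.

Lemma esum_indic (p : int) (a : R) : 0 <= a ->
  (\esum_(m in [set: int]) (if m == p then a else 0)%:E = a%:E)%E.
Proof.
move=> a0; rewrite -(@esum_set1 _ _ p (fun=> a%:E)) ?lee_fin// [RHS]esum_mkcond.
apply: eq_esum => m _; rewrite (_ : (m \in [set p]) = (m == p)); first by case: ifP.
by apply/idP/eqP; rewrite in_setE.
Qed.

Variables (c : int -> bool) (lambda : R[i]) (phi : int -> R[i]) (N : nat).
Hypothesis phiE : forall m, resid c lambda phi m = 0.
Hypotheses (N_ge2 : (2 <= N)%N) (phiN1 : phi (-1) = 0) (phi0 : phi 0 != 0).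
Hypothesis phi_per : forall j : nat,
  normc (phi (j%:Z - 1 + N%:Z)) = normc (phi (j%:Z - 1)).

Lemma normc_phi_per (l j : nat) :
  normc (phi ((l * N)%N%:Z + j%:Z - 1)) = normc (phi (j%:Z - 1)).
Proof.
elim: l j => [|l IH] j; first by rewrite mul0n add0r.
rewrite -(IH j) -[(l * N)%N%:Z + j%:Z]/((l * N + j)%N%:Z) -[RHS]phi_per.
by congr (normc (phi _)); lia.
Qed.

(** Truncation to [L] periods; the support is given as the image of a finite set so that summability
    is immediate. *)
Let cut (L : nat) (m : int) : Cplx R :=
  if m \in [set i%:Z | i in `I_(L * N)] then phi m else 0.

Lemma cutE L m :
  cut L m = if (0 <= m) && (m < (L * N)%N%:Z) then phi m else 0.
Proof.
rewrite /cut; case: ifP; case: ifP => //.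
  move=> h; rewrite in_setE => -[i iL im]; move: h; rewrite -im.
  by move: iL => /=; lia.
move=> /andP[m0 mL] /negP[]; rewrite in_setE; exists `|m|%N => /=; lia.
Qed.

Lemma cut_summable L : cut L \in @sqsummable R.
Proof.
rewrite unfold_in /= /sqsum.
have -> : (\esum_(m in [set: int]) (normc (cut L m) ^+ 2)%:E =
  \esum_(m in [set i%:Z | i in `I_(L * N)]) (normc (phi m) ^+ 2)%:E)%E.
  rewrite [RHS]esum_mkcond; apply: eq_esum => m _; rewrite /cut.
  by case: ifP => // _; rewrite normc0 expr0n.
have fin : finite_set [set i%:Z | i in `I_(L * N)].
  exact/finite_image/finite_II.
rewrite esum_fset//; last by move=> i _; rewrite lee_fin sqr_ge0.
by rewrite fsbig_finite//= sumEFin ltry.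
Qed.

Lemma sqsum_cut_ge L : ((L%:R * normc (phi 0) ^+ 2)%:E <= sqsum (cut L))%E.
Proof.
apply: esum_ge; exists [set (l * N)%N%:Z | l in `I_L].
  by split => //; exact/finite_image/finite_II.
rewrite fsbig_image; last first.
  move=> x y _ _ [] /eqP; rewrite eqn_pmul2r; first by move/eqP.
  by lia.
rewrite -fsbig_ord sumEFin lee_fin.
rewrite (eq_bigr (fun=> normc (phi 0) ^+ 2)) => [|l _].
  by rewrite sumr_const card_ord mulr_natl.
rewrite cutE ifT; last by move: (ltn_ord l) => ?; apply/andP; split; nia.
by rewrite -(normc_phi_per l 1); congr (normc (phi _) ^+ 2); lia.
Qed.

(** phi vanishes at -1 and at L N - 1, so truncation spoils the equation only at these two sites, by
    amounts independent of [L]. *)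
Lemma sqsum_resid_cut L : (0 < L)%N ->
  (sqsum (resid c lambda (cut L)) <=
   (normc (phi 0) ^+ 2 + normc (phi (N%:Z - 2)) ^+ 2)%:E)%E.
Proof.
move=> L0; pose p := (L * N)%N%:Z - 1.
rewrite EFinD -(esum_indic (-1) (sqr_ge0 (normc (phi 0)))).
rewrite -(esum_indic p (sqr_ge0 (normc (phi (N%:Z - 2))))).
rewrite -esumD; try by move=> m _; rewrite lee_fin; case: ifP; rewrite ?sqr_ge0.
have LN : (2 <= L * N)%N by nia.
have phip : phi p = 0.
  apply: eq0_normc; rewrite /p -[(L * N)%N%:Z]addr0 (normc_phi_per L 0).
  by rewrite sub0r phiN1 [normc _]normc0.
apply: le_esum => m _; rewrite -EFinD lee_fin.
have ge0 (b : bool) z : 0 <= if b then normc z ^+ 2 else 0 :> R.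
  by case: b => //; exact: sqr_ge0.
have [->|m1] := eqVneq m (-1).
  apply: ler_wpDr => //; rewrite /resid !cutE /= ifT; last by lia.
  by rewrite !mulr0 add0r subr0 addNr.
rewrite add0r; have [->|mp] := eqVneq m p.
  have -> : resid c lambda (cut L) p = (-1) ^+ c p * phi (p - 1).
    rewrite /resid !cutE [in X in _ + X - _]ifF; last by lia.
    rewrite ifT; last by rewrite /p; lia.
    by rewrite phip if_same mulr0 subr0 addr0.
  rewrite normcM normc_sign mul1r.
  have -> : p - 1 = (L.-1 * N)%N%:Z + (N.-1)%:Z - 1.
    by rewrite /p; case: (L) L0 => // L' _ /=; rewrite mulSn; lia.
  by rewrite normc_phi_per (_ : N.-1%:Z - 1 = N%:Z - 2)//; lia.
rewrite [resid _ _ _ _](_ : _ = 0) ?[normc _]normc0 ?expr0n// -[RHS](phiE m).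
have [h|h] := boolP ((0 <= m) && (m < p)).
  have cutphi k : -1 <= k -> k <= p -> cut L k = phi k.
    move=> k1 k2; rewrite cutE; case: ifP => // /negbT; rewrite negb_and -!ltNge => h'.
    by rewrite (_ : k = -1) ?phiN1//; move: k1 k2 h'; rewrite /p; lia.
  by rewrite /resid !cutphi//; lia.
have cut0 k : (k < 0) || (p <= k) -> cut L k = 0.
  move=> hk; rewrite cutE; case: ifP => // h'.
  by rewrite (_ : k = p) ?phip//; move: hk h'; rewrite /p; lia.
by rewrite phiE /resid !cut0 ?mulr0 ?addr0 ?subr0//; move: h m1 mp; rewrite /p; lia.
Qed.

Lemma periodic_solution_spec :
  spec (hop c : {linear ell2 R -> ell2 R}) lambda.
Proof.
move=> [S [[M SM] SK _]].
set B := normc (phi 0) ^+ 2 + normc (phi (N%:Z - 2)) ^+ 2.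
have p0 : 0 < normc (phi 0) ^+ 2.
  rewrite exprn_gt0// lt_neqAle normc_ge0 andbT eq_sym.
  by apply: contraNneq phi0 => /eq0_normc ->.
(* Enough periods to violate the bound L |phi 0|^2 <= M^2 B that an inverse of norm at most [M]
   would impose. *)
pose L := (Num.truncn (M ^+ 2 * B / normc (phi 0) ^+ 2)).+1.
have LB : M ^+ 2 * B < L%:R * normc (phi 0) ^+ 2.
  by rewrite -ltr_pdivrMr// truncnS_gt.
pose w := Ell2 (cut_summable L).
pose t := hop c w - lambda *: w.
have wt : sqsum w = sqsum (S t) by rewrite SK.
have f1 := sqsum_fin (valP w); have f2 := sqsum_fin (valP t).
have tB : fine (sqsum t) <= B.
  by rewrite -lee_fin fineK//; exact: sqsum_resid_cut.
have wB : L%:R * normc (phi 0) ^+ 2 <= fine (sqsum w).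
  by rewrite -lee_fin fineK//; exact: sqsum_cut_ge.
have := SM t; rewrite SK /l2norm => h.
have fw0 : 0 <= fine (sqsum w) by rewrite fine_ge0// sqsum_ge0.
have ft0 : 0 <= fine (sqsum t) by rewrite fine_ge0// sqsum_ge0.
have h2 : fine (sqsum w) <= M ^+ 2 * fine (sqsum t).
  rewrite -[leLHS]sqr_sqrtr// -[fine (sqsum t)]sqr_sqrtr// -exprMn.
  rewrite ler_sqr ?nnegrE ?sqrtr_ge0//.
  exact: le_trans (sqrtr_ge0 _) h.
move: LB; rewrite ltNge => /negP; apply.
apply: (le_trans wB); apply: (le_trans h2).
by rewrite ler_wpM2l ?sqr_ge0.
Qed.
End PeriodicSolution.

Lemma nth_cat_rev n (k : n.-tuple bool) j : (j < 2 * n)%N ->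
  nth false (k ++ rev k) (2 * n - j.+1) = nth false (k ++ rev k) j.
Proof.
move=> jn; have sz : size (k ++ rev k) = (2 * n)%N.
  by rewrite size_cat size_rev size_tuple mul2n addnn.
by rewrite -[in LHS]sz -nth_rev ?sz// rev_cat revK.
Qed.

(** * Reflection of a solution at one of its zeros *)

Section Reflection.
Variable R : realType.
Variables (c : int -> bool) (lambda : R[i]) (phi : int -> R[i]) (n : nat).
Hypothesis phiE : forall m, resid c lambda phi m = 0.
Hypotheses (phiN1 : phi (-1) = 0) (phin : phi n%:Z = 0).
Hypothesis c_pal : forall j : nat, (0 < j <= 2 * n)%N ->
  c (2 * n%:Z + 1 - j%:Z) = c j%:Z.

Lemma solution_next m :
  phi (m + 1) = lambda * phi m - (-1) ^+ c m * phi (m - 1).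
Proof.
apply/eqP; rewrite -subr_eq0 -[X in _ == X](phiE m) /resid.
by apply/eqP; ring.
Qed.

Lemma solution_reflect i : (i <= n)%N -> exists b : bool,
  phi (n%:Z + i%:Z) = (-1) ^+ b * phi (n%:Z - i%:Z) /\
  phi (n%:Z + i%:Z + 1) =
    (-1) ^+ b * (-1) ^+ c (n%:Z + i%:Z + 1) * phi (n%:Z - i%:Z - 1).
Proof.
elim: i => [_|i IH ilt].
  (* At the zero n the recursion reads phi (n + 1) = - c_n phi (n - 1), whence the initial sign
     -1. *)
  exists true; rewrite !addr0 ?subr0 phin; split; first by rewrite mulr0.
  rewrite solution_next phin mulr0 sub0r expr1 !mulN1r mulNr.
  have [->|n0] := posnP n; first by rewrite sub0r phiN1 !mulr0.
  have -> // : c (n%:Z + 1) = c n%:Z.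
  by rewrite -(c_pal (j := n)); [congr c|]; lia.
have [b [h1 h2]] := IH (ltnW ilt).
exists (b (+) c (n%:Z + i%:Z + 1)); rewrite signr_addb.
rewrite (_ : n%:Z + i.+1%:Z = n%:Z + i%:Z + 1); last by lia.
rewrite (_ : n%:Z - i.+1%:Z = n%:Z - i%:Z - 1); last by lia.
split=> //.
rewrite solution_next addrK h1 h2.
have := solution_next (n%:Z - i%:Z - 1); rewrite subrK => ->.
set x := n%:Z - i%:Z - 1; set s := (-1) ^+ c (n%:Z + i%:Z + 1).
(* The palindrome does not cover the index 0; there the sign multiplies phi (-1) = 0. *)
have [x0|x0] := eqVneq x 0.
  by rewrite x0 sub0r phiN1; ring.
rewrite (_ : c (n%:Z + i%:Z + 1 + 1) = c x); last first.
  have <- : `|x|%N%:Z = x by rewrite /x; lia.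
  by rewrite -c_pal; [congr c|]; move: x0; rewrite /x; lia.
by ring.
Qed.
End Reflection.

(** * Finite eigenvalues lie in the symmetric periodic spectra *)

Section SigmaSubPiS.
Variable R : realType.

Let mirror n (k : n.-tuple bool) := [tuple of (k ++ rev k) ++ [:: true; false]].

Lemma size_cat_rev n (k : n.-tuple bool) : size (k ++ rev k) = (2 * n)%N.
Proof. by rewrite size_cat size_rev size_tuple mul2n addnn. Qed.

Lemma nth_mirror n (k : n.-tuple bool) j : (j < 2 * n)%N ->
  nth false (mirror k) j = nth false (k ++ rev k) j.
Proof. by move=> jn; rewrite /= nth_cat size_cat_rev jn. Qed.

Lemma nth_mirror0 n (k : n.-tuple bool) : nth false (mirror k) (2 * n) = true.
Proof. by rewrite /= nth_cat size_cat_rev ltnn subnn. Qed.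

Lemma nth_mirror1 n (k : n.-tuple bool) :
  nth false (mirror k) (2 * n).+1 = false.
Proof. by rewrite /= nth_cat size_cat_rev ltnNge leqnSn subSnn. Qed.

Lemma mirror_in_K n (k : n.-tuple bool) : (0 < n)%N -> in_K (mirror k).
Proof.
move=> n0; split.
- by lia.
- by rewrite -[RHS](nth_mirror0 k); congr nth; lia.
- by rewrite -[RHS](nth_mirror1 k); congr nth; lia.
- right; split=> [|j jn]; first by lia.
  rewrite !nth_mirror; try by lia.
  by rewrite -nth_cat_rev; [congr nth|]; lia.
Qed.

Lemma sigma_inf_sub_pi_inf_S : sigma_inf R `<=` pi_inf_S R.
Proof.
move=> lambda [n /= n0 [k _ /= ev]].
exists (n + n + 2)%N => //; exists (mirror k); first exact: mirror_in_K.
case: n n0 k ev => // n' _ k; rewrite eigenvalue_A_fin; set n := n'.+1 => /eqP K0.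
pose N := (n + n + 2)%N; pose c := per_seq (mirror k).
have cE (j : nat) : (0 < j <= 2 * n)%N -> c j%:Z = nth false (k ++ rev k) j.-1.
  move=> hj; rewrite /c per_seqE; last by lia.
  by apply: nth_mirror; lia.
have cN1 : c (2 * n%:Z + 1) = true.
  rewrite (_ : 2 * n%:Z + 1 = (2 * n + 1)%N%:Z); last by lia.
  rewrite /c per_seqE; last by lia.
  by rewrite -[RHS](nth_mirror0 k); congr nth; lia.
have c_pal (j : nat) : (0 < j <= 2 * n)%N -> c (2 * n%:Z + 1 - j%:Z) = c j%:Z.
  move=> hj; rewrite (_ : 2 * n%:Z + 1 - j%:Z = (2 * n - j.-1)%N%:Z); last by lia.
  rewrite !cE; try by lia.
  by rewrite -nth_cat_rev; [congr nth|]; lia.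
have [phi [phiE phiN1 phi0]] := resid_solve c (lambda : R[i]) (fun=> 0) (-1) 0 1.
rewrite addNr in phi0.
have phiE' m : resid c lambda phi m = 0 by rewrite phiE.
(* Based at -1, phi is the continuant shifted by one, so the eigenvalue condition is a zero at n. *)
have phin : phi n%:Z = 0.
  rewrite (_ : n%:Z = -1 + n.+1%:Z); last by lia.
  rewrite (resid_recur c lambda) phiE phiN1 addNr phi0 -[RHS]K0.
  rewrite -/(contin lambda (fun i => c (-1 + 1 + i%:Z)) n.+1).
  apply: eq_contin => i ilt; rewrite addNr add0r cE; last by lia.
  by rewrite nth_cat size_tuple ifT//; lia.
have [b [h1 h2]] := solution_reflect phiE' phiN1 phin c_pal (leqnn n).
rewrite subrr phi0 mulr1 in h1; rewrite subrr sub0r phiN1 mulr0 in h2.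
(* Reflection gives phi (2n + 1) = 0, and the extra sign -1 at 2n + 1 gives phi (2n + 2) = phi (2n),
   which is phi 0 up to sign. *)
have h3 : phi (N%:Z + 0) = (-1) ^+ b.
  rewrite (_ : N%:Z + 0 = n%:Z + n%:Z + 1 + 1); last by rewrite /N; lia.
  rewrite (solution_next phiE') addrK h1 h2.
  by rewrite (_ : n%:Z + n%:Z + 1 = 2 * n%:Z + 1) ?cN1; [ring|lia].
have c_per m : c (m + N%:Z) = c m by exact: per_seq_periodic.
have per (j : nat) : phi (-1 + j%:Z + N%:Z) = (-1) ^+ b * phi (-1 + j%:Z).
  (* [psi] solves the same equation and vanishes at -1 and 0, hence everywhere to the right. *)
  pose psi m := phi (m + N%:Z) - (-1) ^+ b * phi m.
  suff: psi (-1 + j%:Z) = 0 by move/eqP; rewrite subr_eq0 => /eqP.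
  have psiE : resid c lambda psi = fun=> 0.
    apply/funext => m; transitivity (resid c lambda phi (m + N%:Z)
        - (-1) ^+ b * resid c lambda phi m); last by rewrite !phiE' mulr0 subr0.
    by rewrite /resid /psi c_per !(addrAC m N%:Z); ring.
  rewrite (resid_recur c lambda) psiE /psi addNr phi0 (addrC 0) h3 phiN1.
  rewrite (_ : -1 + N%:Z = n%:Z + n%:Z + 1); last by rewrite /N; lia.
  by rewrite h2 mulr0 subr0 mulr1 subrr recur00.
apply: (periodic_solution_spec (N := N) phiE') => //.
- by rewrite /N; lia.
- by rewrite phi0 oner_eq0.
- by move=> j; rewrite (addrC j%:Z) per normcM normc_sign mul1r.
Qed.
End SigmaSubPiS.

(** * Approximation by eigenvalues of finite matrices *)

Section RootsNear.
Variable R : realType.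

Lemma normc_prod (s : seq R[i]) (F : R[i] -> R[i]) :
  normc (\prod_(z <- s) F z) = \prod_(z <- s) normc (F z).
Proof. by apply: (big_morph _ (@normcM R)); exact: normc1. Qed.

(** P(x) - y is the product of x - z over the roots z of P - y; were all of them at distance at
    least e, its modulus would be at least e to the degree. *)
Lemma monic_value_near (P : {poly R[i]}) (x y : R[i]) (e : R) :
  P \is monic -> (1 < size P)%N -> 0 < e ->
  normc (P.[x] - y) < e ^+ (size P).-1 ->
  exists2 z, P.[z] = y & normc (x - z) < e.
Proof.
move=> Pm sP e0 near.
have sy : (size (- y%:P) < size P)%N.
  by rewrite size_polyN (leq_ltn_trans (size_polyC_leq1 _)).
have Qm : P - y%:P \is monic by rewrite monicE lead_coefDl// -monicE.
have [r Qr] := closed_field_poly_normal (P - y%:P).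
rewrite (monicP Qm) scale1r in Qr.
have sr : size r = (size P).-1.
  by rewrite -(size_polyDl sy) Qr size_prod_XsubC.
have [[z zr zx]|far] := pselect (exists2 z, z \in r & normc (x - z) < e).
  exists z => //; apply/eqP; rewrite -subr_eq0.
  have : root (P - y%:P) z by rewrite Qr root_prod_XsubC.
  by rewrite /root !hornerE.
exfalso; move: near; rewrite ltNge => /negP; apply.
have -> : P.[x] - y = \prod_(z <- r) (x - z).
  have := congr1 (horner^~ x) Qr; rewrite !hornerE => ->.
  by rewrite horner_prod; apply: eq_bigr => z _; rewrite !hornerE.
rewrite normc_prod -sr; elim: r {Qr sr} far => [|z r IH] far.
  by rewrite big_nil expr0.
rewrite big_cons /= exprS; apply: ler_pM; rewrite ?exprn_ge0 ?(ltW e0)//.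
  by rewrite leNgt; apply/negP => h; apply: far; exists z; rewrite ?mem_head.
by apply: IH => -[w wr h]; apply: far; exists w; rewrite // inE wr orbT.
Qed.
End RootsNear.

(** * The trace as a monic polynomial in the spectral parameter *)

Section TracePolynomial.
Variable F : idomainType.

Lemma horner_sign (b : bool) (x : F) : ((-1) ^+ b : {poly F}).[x] = (-1) ^+ b.
Proof. by case: b; rewrite ?expr1 ?expr0 ?hornerN hornerC. Qed.

Lemma horner_contin (s : nat -> bool) j (x : F) :
  (contin 'X s j).[x] = contin x s j.
Proof.
elim/ltn_ind: j => -[_|[_|j IH]]; rewrite ?horner0 ?hornerC//.
by rewrite !continSS hornerD hornerN !hornerM hornerX horner_sign !IH.
Qed.

Lemma contin_monic (s : nat -> bool) j :
  contin ('X : {poly F}) s j.+1 \is monic /\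
  size (contin ('X : {poly F}) s j.+1) = j.+1.
Proof.
elim/ltn_ind: j => -[_|j IH]; first by rewrite monic1 size_poly1.
have [m1 s1] := IH j (leqnn _).
have s0 : (size (contin ('X : {poly F}) s j) <= j)%N.
  by case: j IH {m1 s1} => [_|j IH]; [rewrite size_poly0|rewrite (IH j _).2//; lia].
have sX : size ('X * contin ('X : {poly F}) s j.+1) = j.+2.
  by rewrite mulrC size_mulX ?s1// -size_poly_gt0 s1.
have lt : (size (- ((-1) ^+ s j * contin ('X : {poly F}) s j)) <
    size ('X * contin ('X : {poly F}) s j.+1)%R)%N.
  rewrite sX size_polyN; case: (s j); rewrite ?expr1 ?expr0 ?mul1r ?mulN1r ?size_polyN.
    exact: (leq_ltn_trans s0 (leqnSn _)).
  exact: (leq_ltn_trans s0 (leqnSn _)).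
rewrite continSS size_polyDl// sX; split => //.
by rewrite monicE lead_coefDl// mulrC lead_coefMX -monicE.
Qed.

Variables (n : nat) (c : int -> bool).

Definition trace_poly : {poly F} := trace_per n c 'X 0.

Lemma horner_trace_poly x : trace_poly.[x] = trace_per n c x 0.
Proof.
by rewrite /trace_poly /trace_per hornerD hornerN hornerM horner_sign !horner_contin.
Qed.

Lemma trace_poly_monic : trace_poly \is monic /\ size trace_poly = n.+2.
Proof.
rewrite /trace_poly /trace_per; set s := fun i => _; set s' := fun i => _.
have [m1 s1] := contin_monic s n.+1.
have lt : (size (- ((-1) ^+ c (0 + 1) * contin ('X : {poly F}) s' n)) <
    size (contin ('X : {poly F}) s n.+2))%N.
  have s0 : (size (contin ('X : {poly F}) s' n) <= n)%N.
    by case: (n) => [|n']; [rewrite size_poly0|rewrite (contin_monic s' n').2].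
  rewrite s1 size_polyN; case: (c _); rewrite ?expr1 ?expr0 ?mul1r ?mulN1r ?size_polyN.
    exact: (leq_ltn_trans s0 (leqnSn _)).
  exact: (leq_ltn_trans s0 (leqnSn _)).
by rewrite size_polyDl// monicE lead_coefDl// -monicE.
Qed.
End TracePolynomial.

(** * Density of roots of unity in the unit circle *)

Section RootsOfUnity.
Variable R : realType.

(** The exponential of i x or its conjugate: [b] carries the sign of the imaginary part, so that
    angles stay in [0, pi], the range of [acos]. *)
Let cis (b : bool) (x : R) : R[i] := Complex (cos x) ((-1) ^+ b * sin x).

Lemma cisD b x y : cis b (x + y) = cis b x * cis b y.
Proof.
rewrite /cis cosD sinD; apply/eqP; rewrite eq_complex /=.
by case: b; rewrite ?expr1 ?expr0; apply/andP; split; apply/eqP; ring.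
Qed.

Lemma cis0 b : cis b 0 = 1.
Proof. by rewrite /cis cos0 sin0 mulr0. Qed.

Lemma cisMn b x k : cis b (x *+ k) = cis b x ^+ k.
Proof.
by elim: k => [|k IH]; rewrite ?mulr0n ?cis0// mulrS cisD IH exprS.
Qed.

Lemma cis_pi2 b : cis b (pi *+ 2) = 1.
Proof.
rewrite mulr2n cisD /cis cospi sinpi mulr0.
by apply/eqP; rewrite eq_complex /=; apply/andP; split; apply/eqP; ring.
Qed.

Lemma cis_surj (r : R[i]) : normc r = 1 ->
  exists b t, 0 <= t <= pi /\ r = cis b t.
Proof.
move=> r1; have := sqr_normc_Re_Im r; rewrite r1 expr1n; case: r r1 => x y /= _ e.
have x1 : -1 <= x <= 1.
  by have := sqr_ge0 y; move: e => /= e ?; apply/andP; split; nra.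
exists (y < 0), (acos x); rewrite acos_ge0// acos_lepi//; split=> //.
rewrite /cis acosK ?in_itv//= sin_acos//.
rewrite (_ : 1 - x ^+ 2 = y ^+ 2); last by rewrite e; ring.
rewrite sqrtr_sqr; congr Complex.
case: (ltrP y 0) => y0; first by rewrite ltr0_norm// mulrNN mul1r.
by rewrite ger0_norm// mul1r.
Qed.

(* The conditions on [r ^+ 2] make [r] and [d / r] distinct both for d = 1 and
   for d = -1. *)
Lemma root_of_unity_near (r0 : R[i]) (e : R) : normc r0 = 1 -> 0 < e ->
  exists r q, [/\ (0 < q)%N, r ^+ (2 * q) = 1, r ^+ 2 != 1, r ^+ 2 != -1 &
    normc (r - r0) < e].
Proof.
move=> r01 e0; have [b [t [/andP[t0 tpi] ->]]] := cis_surj r01.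
have e20 : 0 < e / 2 by rewrite divr_gt0.
have [d d0 near] : exists2 d, 0 < d & forall s, `|t - s| < d ->
    normc (cis b s - cis b t) < e.
  have /cvgrPdist_lt/(_ _ e20) hc := @continuous_cos R t.
  have /cvgrPdist_lt/(_ _ e20) hs := @continuous_sin R t.
  have [d /= d0 hd] := filterI hc hs.
  exists d => // s /hd[hcs hss].
  change (normc (cis b s - cis b t) < e).
  have -> : cis b s - cis b t = Complex (cos s - cos t) 0 +
      Complex 0 ((-1) ^+ b * (sin s - sin t)) :> R[i].
    by apply/eqP; rewrite eq_complex /=; apply/andP; split; apply/eqP; ring.
  apply: (le_lt_trans (le_normcD _ _)).
  rewrite /= !expr0n /= addr0 add0r !sqrtr_sqr normrM normrX normrN1 expr1n mul1r.
  rewrite distrC (distrC (sin s)); rewrite [ltRHS](splitr e).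
  exact: ltrD.
have pi0 := pi_gt0 R.
(* A rational multiple of pi near [t], chosen strictly inside the first or the second quadrant to
   keep sine and cosine nonzero. *)
have [x [x0 xt xs xc]] : exists x : rat, [/\ 0 < ratr x :> R,
    `|t - ratr x * pi| < d, sin (ratr x * pi : R) != 0 & cos (ratr x * pi : R) != 0].
  have [t2|t2] := leP t (pi / 2).
    have [|x] := @rat_in_itvoo R (Num.max 0 ((t - d) / pi))
        (Num.min (1/2) ((t + d) / pi)).
      have td : 0 < (t + d) / pi by rewrite divr_gt0//; lra.
      rewrite lt_min !gt_max ltr_pM2r ?invr_gt0// ltr_pdivrMr// td.
      by repeat (apply/andP; split); lra.
    rewrite in_itv /= gt_max lt_min => /andP[/andP[x0 xl] /andP[xh xu]].
    rewrite ltr_pdivrMr// in xl; rewrite (@ltr_pdivlMr _ pi)// in xu.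
    exists x; split=> //.
    - by rewrite ltr_norml; lra.
    - by rewrite gt_eqF// sin_gt0_pihalf// mulr_gt0//=; nra.
    - by rewrite gt_eqF// cos_gt0_pihalf//; apply/andP; split; nra.
  have [|x] := @rat_in_itvoo R (Num.max (1/2) ((t - d) / pi))
      (Num.min 1 ((t + d) / pi)).
    have td1 : (t - d) / pi < 1 by rewrite ltr_pdivrMr//; lra.
    have td2 : 1 / 2 < (t + d) / pi by rewrite (@ltr_pdivlMr _ pi)//; lra.
    rewrite lt_min !gt_max ltr_pM2r ?invr_gt0// td1 td2.
    by repeat (apply/andP; split); lra.
  rewrite in_itv /= gt_max lt_min => /andP[/andP[x0 xl] /andP[xh xu]].
  rewrite ltr_pdivrMr// in xl; rewrite (@ltr_pdivlMr _ pi)// in xu.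
  exists x; split=> //.
  - by lra.
  - by rewrite ltr_norml; lra.
  - by rewrite gt_eqF// sin_gt0_pi//; apply/andP; split; nra.
  - rewrite lt_eqF//.
    have -> : ratr x * pi = (ratr x * pi - pi / 2) + pi / 2 :> R by ring.
    rewrite cosDpihalf oppr_lt0 sin_gt0_pihalf//; apply/andP; split; nra.
(* Up to sign this is 2 sin cos; a non-real square is neither 1 nor -1. *)
have im : complex.Im (cis b (ratr x * pi) ^+ 2) != 0.
  rewrite expr2 /= (mulrC (cos _)) -mulr2n mulrn_eq0 !mulf_eq0 signr_eq0.
  by rewrite (negbTE xs) (negbTE xc).
exists (cis b (ratr x * pi)), `|denq x|%N; split.
- by rewrite absz_gt0 denq_eq0.
- rewrite -cisMn.
  have -> : (ratr x * pi : R) *+ (2 * `|denq x|) = pi *+ 2 *+ `|numq x|.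
    have xq : ratr x * (`|denq x|%N)%:R = (`|numq x|%N)%:R :> R.
      have nx : (0 <= numq x)%R by rewrite numq_ge0 ltW// -(ltr0q R).
      rewrite -[(`|numq x|%N)%:R]/((`|numq x|%N)%:Z%:~R) gez0_abs//.
      rewrite -[(`|denq x|%N)%:R]/((`|denq x|%N)%:Z%:~R) gez0_abs ?denq_ge0//.
      by rewrite /ratr divfK// intr_eq0 denq_neq0.
    rewrite -mulr_natr -[RHS]mulr_natr natrM -xq mulr2n.
    by move: (ratr x : R) (`|denq x|%N%:R : R) (pi : R) => u v w; ring.
  by rewrite cisMn cis_pi2 expr1n.
- by apply: contraNneq im => ->.
- by apply: contraNneq im => ->; rewrite /= oppr0.
- exact: near.
Qed.
End RootsOfUnity.

(** * Periodic spectra as limits of finite eigenvalues *)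

Section PiSubClosureSigma.
Variable R : realType.

Lemma normc_det_per n c : normc (det_per R[i] n c) = 1.
Proof.
rewrite /det_per; elim/big_rec: _ => [|i y _ IH]; first exact: normc1.
by rewrite normcM normc_sign IH mulr1.
Qed.

Lemma det_per_sqr n c : det_per R[i] n c ^+ 2 = 1.
Proof.
rewrite /det_per; elim/big_rec: _ => [|i y _ IH]; first exact: expr1n.
by rewrite exprMn sqrr_sign mul1r.
Qed.

Lemma spec_discriminant n c (lambda : R[i]) :
  (forall m, c (m + n.+1%:Z) = c m) ->
  spec (hop c : {linear ell2 R -> ell2 R}) lambda ->
  exists2 r, normc r = 1 &
    r + det_per R[i] n c / r = trace_per n c lambda 0.
Proof.
move=> c_per sp; set t := trace_per _ _ _ _; set d := det_per _ _ _.
pose w := sqrtc (t ^+ 2 - 4 * d).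
pose r1 := (t + w) / 2; pose r2 := (t - w) / 2.
have r12D : r1 + r2 = t by rewrite /r1 /r2; field.
have r12M : r1 * r2 = d.
  have : w ^+ 2 = t ^+ 2 - 4 * d by rewrite sqr_sqrtc.
  rewrite /r1 /r2 => e; transitivity ((t ^+ 2 - w ^+ 2) / 4); first by field.
  by rewrite e; field.
have nM : normc r1 * normc r2 = 1 by rewrite -normcM r12M normc_det_per.
have [n1|n1] := eqVneq (normc r1) 1.
  exists r1 => //; rewrite -r12D -r12M mulrAC divff ?mul1r//.
  by apply: contra_eq_neq nM => ->; rewrite [normc 0]normc0 mul0r eq_sym oner_eq0.
(* The roots have product of modulus 1, so one lies inside and the other outside the unit circle;
   the second case exchanges them. *)
exfalso; have [lt1|gt1] : normc r1 < 1 \/ 1 < normc r1.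
  by case: ltgtP n1 => //; [left|right].
- apply: (notin_spec_hop c_per r12D r12M lt1 _ sp).
  by have := normc_ge0 r1; have := normc_ge0 r2; nra.
- rewrite addrC in r12D; rewrite mulrC in r12M.
  apply: (notin_spec_hop c_per r12D r12M _ gt1 sp).
  by have := normc_ge0 r1; have := normc_ge0 r2; nra.
Qed.

Lemma contin_eq0_sigma (c : int -> bool) (lambda : R[i]) N : (2 <= N)%N ->
  contin lambda (fun i => c i.+1%:Z) N = 0 -> sigma_inf R lambda.
Proof.
case: N => [//|[//|n]] _ K0; exists n.+1 => //.
(* The signs that matter start at index 1, where the shifted sequence has the value c 2. *)
exists [tuple c (val i).+2%:Z | i < n.+1] => //=.
rewrite eigenvalue_A_fin -[X in _ == X]K0; apply/eqP; apply: eq_contin => i ilt.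
have ilt' : (i < n.+1)%N by lia.
have := tnth_mktuple (fun j : 'I_n.+1 => c (val j).+2%:Z) (Ordinal ilt').
by rewrite (tnth_nth false).
Qed.

Lemma sigma_near_pi n (k : n.+1.-tuple bool) (lambda : R[i]) (e : R) : 0 < e ->
  spec (A_per R k) lambda -> exists2 mu, sigma_inf R mu & normc (lambda - mu) < e.
Proof.
move=> e0 sp; set c := per_seq k.
have c_per m : c (m + n.+1%:Z) = c m by exact: per_seq_periodic.
have [r0 r01 r0E] := spec_discriminant c_per sp.
set d := det_per _ _ _ in r0E; have d1 : normc d = 1 by exact: normc_det_per.
have [Pm Ps] := trace_poly_monic R[i] n c.
pose P := trace_poly R[i] n c.
(* The trace has degree n + 1, and r + d / r moves by at most 2 |r - r0| on the unit circle. *)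
have e' : 0 < e ^+ n.+1 / 2 by rewrite divr_gt0// exprn_gt0.
have [r [q [q0 rq r1 rN1 near]]] := root_of_unity_near r01 e'.
have [r_0 r0_0] : r != 0 /\ r0 != 0.
  split; first by apply: contraNneq r1 => r00; move: rq; rewrite r00 expr0n
      gtn_eqF ?muln_gt0 ?q0// => /esym/eqP; rewrite oner_eq0.
  by apply: contra_eq_neq r01 => ->; rewrite [normc 0]normc0 eq_sym oner_eq0.
have nr : normc r = 1.
  apply/eqP; rewrite -(@pexpr_eq1 _ _ (2 * q)) ?normc_ge0 ?muln_gt0//.
  by rewrite -normcX rq [normc 1]normc1.
have [||mu muE mu_near] := @monic_value_near R P lambda (r + d / r) e Pm _ e0.
- by rewrite Ps.
- rewrite Ps /= horner_trace_poly -r0E.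
  have -> : r0 + d / r0 - (r + d / r) = (r0 - r) + d / (r0 * r) * (r - r0).
    by field; rewrite r_0.
  apply: (le_lt_trans (le_normcD _ _)); rewrite !normcM normcV normcM r01 nr d1.
  rewrite mulr1 invr1 !mul1r -normcN opprB.
  by move: near; lra.
exists mu => //; apply: (@contin_eq0_sigma c mu (n.+1 * (2 * q))); first by nia.
have dq : d ^+ (2 * q) = 1 by rewrite exprM det_per_sqr expr1n.
apply: (@contin_periodic_eq0 _ n c c_per mu r (d / r)) => //.
(* Equal multipliers would mean r^2 = d, and d is 1 or -1. *)
- apply/eqP => h; have r2d : r ^+ 2 = d by rewrite expr2 {2}h mulrCA divff// mulr1.
  have := det_per_sqr n c; rewrite -/d -r2d => /eqP; rewrite sqrf_eq1.
  by rewrite (negbTE r1) (negbTE rN1).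
- by rewrite expr_div_n dq rq divr1.
- by rewrite -muE horner_trace_poly.
- by rewrite mulrCA divff// mulr1.
Qed.

Lemma pi_inf_S_sub_pi_inf : pi_inf_S R `<=` pi_inf R.
Proof.
move=> lambda [n _ [k [n2 _ _ _] sp]]; exists n; first exact: leq_trans n2.
by exists k.
Qed.

Lemma pi_inf_sub_closure_sigma_inf : pi_inf R `<=` closure (sigma_inf R).
Proof.
move=> lambda [[//|n] _ [k _ sp]] B /nbhs_ballP[e /= e0 eB].
(* Balls have radii in [R[i]]; a positive one is real. *)
have er : e = (complex.Re e)%:C%C.
  by move: e0; rewrite ltcE => /andP[/eqP]; case: e {eB} => ? ? /= ->.
have e0' : 0 < complex.Re e by move: e0; rewrite er ltcR.
have [mu mus mun] := sigma_near_pi e0' sp.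
exists mu; split => //; apply: eB.
by rewrite -ball_normE /ball_ /= er ltcR.
Qed.
End PiSubClosureSigma.

Unset Implicit Arguments.

Theorem theorem3p8 (R : realType) :
  [/\ sigma_inf R `<=` pi_inf_S R,
      dense_in (pi_inf_S R) (Sigma_pi R),
      Sigma_pi R = closure (pi_inf R),
      closure (pi_inf R) = closure (sigma_inf R) &
      closure (sigma_inf R) = closure (pi_inf_S R)].
Proof.
have sigS := @sigma_inf_sub_pi_inf_S R.
have Spi := @pi_inf_S_sub_pi_inf R.
have pisig := @pi_inf_sub_closure_sigma_inf R.
(* The chain [sigma_inf], [pi_inf_S], [pi_inf], closure of [sigma_inf] is increasing, so all
   closures coincide. *)
have pi_sig : closure (pi_inf R) = closure (sigma_inf R).
  apply/seteqP; split; last by apply: closure_subset => x /sigS /Spi.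
  move=> x /(closure_subset pisig).
  by rewrite -(closure_id _).1//; exact: closed_closure.
have sig_S : closure (sigma_inf R) = closure (pi_inf_S R).
  apply/seteqP; split; first exact: closure_subset.
  by rewrite -pi_sig; exact: closure_subset.
split=> //; split; first by move=> x /Spi; exact: subset_closure.
by rewrite /Sigma_pi pi_sig sig_S.
Qed.
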